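(* There exists an absolute constant $C>0$ such that the following holds for all positive integers $n$ and $s$. Let $K$ be a Jordan curve that is either $x$-monotone or star-shaped, and let $G$ be the visibility graph of a set of $n$ points of $K$ with respect to $K$. If $G$ contains no $K_{s,s}$, then $G$ has at most $C s n$ edges.
   Context: $K$ is a closed Jordan curve in the plane and $K^*$ denotes the region bounded by $K$. For a finite set $P\subset K$, the visibility graph of $P$ with respect to $K$ is the graph with vertex set $P$ in which distinct $x,y\in P$ are adjacent if the straight line segment connecting $x$ and $y$ is completely contained in $K^*$. $K$ is $x$-monotone if every vertical line intersects $K$ in at most $2$ points. $K$ is star-shaped if there is a point $c\in K^*$ such that every half-line starting at $c$ intersects $K$ in one point. $K_{s,s}$ is the complete bipartite graph with both parts of size $s$; containment is as a (not necessarily induced) subgraph. *)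

(* Defs.v *)
From HB Require Import structures.
From mathcomp Require Import all_boot all_order all_algebra finmap.
From mathcomp Require Import all_classical all_reals all_analysis.
Set Implicit Arguments.
Unset Strict Implicit.
Unset Printing Implicit Defensive.
Import Order.TTheory GRing.Theory Num.Theory.
Import numFieldNormedType.Exports.

(* A graph is given by its adjacency relation, assumed symmetric and
   irreflexive. *)
Definition edges (V : finType) (G : rel V) : {set {set V}} :=
  [set e : {set V} | [exists x, exists y, G x y && (e == [set x; y])]].

Definition contains_Kss (V : finType) (G : rel V) (s : nat) : Prop :=
  exists A B : {set V},
    [/\ #|A| = s, #|B| = s, [disjoint A & B] &
        forall x y, x \in A -> y \in B -> G x y].

Section Plane.
Variable R : realType.
Local Open Scope classical_set_scope.
Local Open Scope ring_scope.

Notation plane := (R * R)%type.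

Definition jordan_curve (K : set plane) : Prop :=
  exists gamma : R -> plane,
    [/\ {within `[0, 1], continuous gamma},
        gamma 0 = gamma 1,
        set_inj `[0, 1[ gamma &
        K = gamma @` `[0, 1] ].

(* The closed region: the curve together with the bounded components of its
   complement (exactly one, by the Jordan curve theorem). The curve itself has
   to be included, as the segments considered below have their endpoints on it. *)
Definition region (K : set plane) : set plane :=
  K `|` [set p | ~ K p /\ bounded_set (connected_component (~` K) p)].

Definition segment (x y : plane) : set plane :=
  [set (1 - t) *: x + t *: y | t in `[0, 1]].

Definition half_line (c v : plane) : set plane :=
  [set c + t *: v | t in `[0, +oo[].

Definition vertical_line (a : R) : set plane := [set p | p.1 = a].

Definition x_monotone (K : set plane) : Prop :=
  forall a : R, (K `&` vertical_line a #<= `I_2)%card.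

Definition star_shaped (K : set plane) : Prop :=
  exists2 c, region K c &
    forall v : plane, v != 0 -> exists p, K `&` half_line c v = [set p].

Definition visibility_graph (K : set plane) (P : {fset plane}) : rel P :=
  fun x y => (x != y) && `[< segment (val x) (val y) `<=` region K >].

End Plane.

Arguments visibility_graph {R} K P.

(* Main.v *)
Require Import Defs.
From mathcomp Require Import all_boot all_order all_algebra finmap.
From mathcomp Require Import all_classical all_reals all_analysis.
From mathcomp Require Import zify ring lra.
Import Order.TTheory GRing.Theory Num.Theory.
Import numFieldNormedType.Exports.

(** The visible pairs are split into a bounded number of classes, and each class
    is shown to have [O(s n)] pairs by one of two counting theorems about
    linearly ordered sets.

    The first, [crossing_bound], counts the crossings between horizontal and
    vertical segments: without a [K_{s,s}] among [m] segments there are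
    [O(s m)] crossings.  From a crossing, take the next [2s] vertical segments
    to the right and then the next [2s] horizontal segments above that meet the
    strip so obtained.  If at least [s] of the latter span the strip and at
    least [s] of the former reach that far up, they form a [K_{s,s}].
    Otherwise at least [s] segments end inside this small window, and every
    endpoint is found by at most [(2s)^2] crossings.  A relation between two
    ordered sets has this form as soon as a cell with related cells to its left
    and right in its row and below and above in its column is itself related;
    this is [biconvex_bound].

    The second, [ordered_bound], concerns an ordered graph in which two crossing
    edges [ac] and [bd] (with [a < b < c < d]) force [ad] to be an edge whenever
    some edge [pq] covers [a] and [d].  Cut the order greedily at points
    [b_0 < b_1 < ...], where [b_(k+1)] is the furthest point reached by an edge
    from a point not beyond [b_k].  An edge then crosses at most one cut.  The
    edges that stay between two consecutive cuts are covered by a common edge,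
    so among them crossing always produces the outer edge, and without a
    [K_{s,s}] each of them is among the [s] longest at one of its ends; the
    edges across a cut satisfy the hypothesis of [biconvex_bound].

    For an x-monotone curve each point is the top or the bottom of its vertical
    line, and the region is vertically convex.  For two tops a crossing keeps
    the outer segment below the roof and a covering segment keeps it above the
    floor, so tops (and, upside down, bottoms) obey [ordered_bound].  A top and
    a bottom to its right see each other as soon as the top sees a bottom
    further right and the bottom sees a top further left, so these pairs obey
    [biconvex_bound].  Pairs on a common vertical line are at most [n].

    For a star-shaped curve, cut along the horizontal line through the centre.
    There the roof is the only obstacle, and two sight lines that cross force
    the outer one, provided the outer angle is less than a half turn.  Pairs in
    one open half-plane obey [ordered_bound].  Pairs in opposite half-planes are
    split according to the side on which they pass the centre, and
    [biconvex_bound] applies to each side: the entry further along the row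
    bounds the angle by a half turn.  The line itself contains two points of the
    curve.

    The only topology needed is that of the complement: a point from which a
    half-line runs to infinity without meeting the curve is outside the region,
    a segment from the centre that misses the curve stays inside, and the set of
    points strictly between two curve points of the same vertical line is open
    and closed in the complement.  The last fact rests on [two_arcs]. *)

Set Implicit Arguments.
Unset Strict Implicit.
Unset Printing Implicit Defensive.

(** * Finite sets with a linear order *)

Local Open Scope nat_scope.

Section Counting.
Variables (T : finType) (key : T -> nat).
Hypothesis key_inj : injective key.

(** The least element of the set so defined sees all the others above it, and
    these are fewer than [t].  The counting arguments below always bound the
    number of possible origins of a charge in this form: a point is
    determined, up to [t] choices, by having few points of a set after it. *)
Lemma few_last (S : {set T}) t :
  #|[set x in S | #|[set y in S | key x < key y]| < t]| <= t.
Proof.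
set X := [set x in S | _].
have [->|[x0 x0X]] := set_0Vmem X; first by rewrite cards0.
case: (arg_minnP key x0X) => x xX xmin.
have {}xX : x \in X := xX.
have: X :\ x \subset [set y in S | key x < key y].
  apply/fintype.subsetP=> y; rewrite /X !inE => /andP[yx /andP[yS ycard]]; rewrite yS /=.
  rewrite ltn_neqAle (inj_eq key_inj) eq_sym yx /=.
  have yX : y \in X by rewrite /X inE yS.
  exact: xmin.
move/subset_leq_card; move: (xX); rewrite {1}/X inE => /andP[_].
by rewrite (cardsD1 x X) xX /=; lia.
Qed.

Lemma first_block (S : {set T}) t : 0 < t <= #|S| ->
  exists2 b, b \in S & #|[set y in S | key y <= key b]| = t.
Proof.
move: {2}#|S| (leqnn #|S|) => n; elim: n S => [|n IHn] S leSn tS; first lia.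
have [x0 x0S] : exists x, x \in S by apply/card_gt0P; lia.
case: (arg_maxnP key x0S) => x xS xmax.
have {}xS : x \in S := xS.
have [eqt|net] := eqVneq t #|S|.
  exists x => //; rewrite eqt; congr #|pred_of_set _|; apply/setP=> y.
  by rewrite inE andb_idr // => yS; apply: xmax.
have cS : #|S| = #|S :\ x|.+1 by rewrite (cardsD1 x) xS.
case: (IHn (S :\ x)) => [||b bS' bt]; [lia|lia|].
have bS : b \in S by move: bS'; rewrite inE => /andP[].
have bx : b != x by move: bS'; rewrite !inE => /andP[].
exists b => //; rewrite -bt; congr #|pred_of_set _|; apply/setP=> y.
rewrite !inE; case: (eqVneq y x) => [->|] //=; rewrite xS /=.
have nbx : key b != key x by rewrite (inj_eq key_inj).
by have /= := xmax b bS; lia.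
Qed.
End Counting.

Lemma few_first (T : finType) (key : T -> nat) (S : {set T}) t :
  injective key ->
  #|[set x in S | #|[set y in S | key y < key x]| < t]| <= t.
Proof.
move=> key_inj; pose N := \max_x key x.
have keyN x : key x <= N by apply: leq_bigmax.
have := @few_last T (fun x => N - key x) _ S t.
have e x y : (N - key x < N - key y) = (key y < key x).
  by have := keyN x; have := keyN y; lia.
under eq_finset => x do under eq_finset => y do rewrite e.
apply; move=> x y /= exy; apply: key_inj.
by have := keyN x; have := keyN y; lia.
Qed.

Lemma double_count (T U : finType) (X : {set T}) (r : T -> U -> bool) s k :
  (forall x, x \in X -> s <= #|[set u | r x u]|) ->
  (forall u, #|[set x in X | r x u]| <= k) ->
  s * #|X| <= k * #|U|.
Proof.
move=> Hs Hk; have -> : s * #|X| = \sum_(x in X) s by rewrite sum_nat_const mulnC.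
apply: (@leq_trans (\sum_(x in X) \sum_(u | r x u) 1)).
  apply: leq_sum => x xX; rewrite sum1_card; apply: leq_trans (Hs x xX) _.
  by rewrite cardsE.
rewrite (exchange_big_dep predT) //=.
have -> : k * #|U| = \sum_(u : U) k by rewrite sum_nat_const mulnC.
apply: leq_sum => u _; rewrite sum1_card; apply: leq_trans (Hk u).
by rewrite cardsE.
Qed.

Lemma card_pairs_le (I J : finType) (P : I -> J -> bool) (S : {set I}) k :
  (forall i j, P i j -> i \in S) -> (forall i, i \in S -> #|[set j | P i j]| <= k) ->
  #|[set e : I * J | P e.1 e.2]| <= k * #|S|.
Proof.
move=> PS Pk; have -> : #|[set e : I * J | P e.1 e.2]| = \sum_(i in S) \sum_(j | P i j) 1.
  rewrite pair_big_dep /= sum1_card cardsE; apply: eq_card => -[i j].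
  by rewrite !unfold_in /= andb_idl //; apply: PS.
have -> : k * #|S| = \sum_(i in S) k by rewrite sum_nat_const mulnC.
apply: leq_sum => i iS; rewrite sum1_card; apply: leq_trans (Pk i iS).
by rewrite cardsE.
Qed.

Lemma card_swap (I J : finType) (P : I -> J -> bool) :
  #|[set e : I * J | P e.1 e.2]| = #|[set e : J * I | P e.2 e.1]|.
Proof.
pose sw (e : I * J) := (e.2, e.1).
have sw_inj : injective sw by move=> [a b] [c d] [-> ->].
rewrite -(card_imset _ sw_inj); apply: eq_card => -[j i]; rewrite inE /=.
apply/imsetP/idP => [[e + [-> ->]]|Pij]; first by rewrite inE.
by exists (i, j); rewrite ?inE.
Qed.

Lemma last_in_row (I J : finType) (key : J -> nat) (P : I -> J -> bool) t :
  injective key ->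
  #|[set e : I * J | P e.1 e.2 &
       #|[set j in [set j | P e.1 j] | key e.2 < key j]| < t]| <= t * #|I|.
Proof.
move=> key_inj; rewrite -cardsT; apply: (@card_pairs_le _ _ (fun i j => P i j &&
  (#|[set j' in [set j' | P i j'] | key j < key j']| < t))) => // i _.
apply: leq_trans (few_last key_inj [set j | P i j] t).
by apply/subset_leq_card/fintype.subsetP=> j; rewrite !inE.
Qed.

Lemma last_in_column (I J : finType) (key : I -> nat) (P : I -> J -> bool) t :
  injective key ->
  #|[set e : I * J | P e.1 e.2 &
       #|[set i in [set i | P i e.2] | key e.1 < key i]| < t]| <= t * #|J|.
Proof.
move=> key_inj; rewrite (card_swap (fun i j => P i j &&
  (#|[set i' in [set i' | P i' j] | key i < key i']| < t))).
exact: last_in_row (fun j i => P i j) t key_inj.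
Qed.

(** * Crossings of horizontal and vertical segments *)

(** The parts may be larger than [s], which spares cutting them down at every
    use; [biclique_free_sub] does it once. *)
Definition biclique_free (I J : finType) (E : I -> J -> bool) (s : nat) :=
  forall (A : {set I}) (B : {set J}), s <= #|A| -> s <= #|B| ->
    (forall i j, i \in A -> j \in B -> E i j) -> False.

Section Segments.
Variables (I J : finType) (rk : I -> nat) (ck : J -> nat).
Variables (lo hi : I -> nat) (lo' hi' : J -> nat) (s : nat).
Hypotheses (rk_inj : injective rk) (ck_inj : injective ck).

(** Row [i] is the horizontal segment at height [rk i] over [[lo i, hi i]] and
    column [j] the vertical segment at abscissa [ck j] over [[lo' j, hi' j]]. *)
Definition crossing i j := (lo i <= ck j <= hi i) && (lo' j <= rk i <= hi' j).

Let t := 2 * s.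
Let row_end (u : I * bool) := if u.2 then lo u.1 else hi u.1.
Let near_row (e : I * J) m :=
  #|[set j in [set j | crossing e.1 j & ck j <= m] | ck e.2 < ck j]| < t.

(** A crossing [e] charges the end [row_end u] of a row above it if that end is
    within reach both along the row of [e] and upwards. *)
Let row_charge (e : I * J) (u : I * bool) :=
  [&& crossing e.1 e.2, rk e.1 < rk u.1, ck e.2 <= row_end u <= hi e.1,
      near_row e (row_end u) &
      #|[set i in [set i | rk i < rk u.1 & lo i <= row_end u <= hi i]
         | rk e.1 < rk i]| < t].

Let col_charge (e : I * J) (d : J) :=
  [&& crossing e.1 e.2, crossing e.1 d, ck e.2 <= ck d, near_row e (ck d) &
      #|[set i in [set i | crossing i d] | rk e.1 < rk i]| < t].

Let near_row_le i m :
  #|[set j | [&& crossing i j, ck j <= m & near_row (i, j) m]]| <= t.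
Proof.
apply: leq_trans (few_last ck_inj [set j | crossing i j & ck j <= m] t).
by apply/subset_leq_card/fintype.subsetP=> j; rewrite !inE andbA.
Qed.

Let row_charge_le u : #|[set e | row_charge e u]| <= t * t.
Proof.
set S := [set i in [set i | rk i < rk u.1 & lo i <= row_end u <= hi i]
          | #|[set i' in [set i | rk i < rk u.1 & lo i <= row_end u <= hi i]
               | rk i < rk i']| < t].
apply: (@leq_trans (t * #|S|)); last by rewrite leq_mul2l few_last ?orbT.
rewrite (_ : [set e | _] = [set e | row_charge (e.1, e.2) u]); last first.
  by apply/setP=> -[i j]; rewrite !inE.
apply: (@card_pairs_le _ _ (fun i j => row_charge (i, j) u)) => [i j|i _].
  case/and5P=> /= /andP[/andP[lij _] _] iu /andP[ju uh] _ few.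
  by rewrite inE few andbT inE iu uh (leq_trans lij ju).
apply: leq_trans (near_row_le i (row_end u)).
apply/subset_leq_card/fintype.subsetP=> j; rewrite !inE.
by case/and5P=> /= -> _ /andP[-> _] -> _.
Qed.

Let col_charge_le d : #|[set e | col_charge e d]| <= t * t.
Proof.
set S := [set i in [set i | crossing i d]
          | #|[set i' in [set i | crossing i d] | rk i < rk i']| < t].
apply: (@leq_trans (t * #|S|)); last by rewrite leq_mul2l few_last ?orbT.
rewrite (_ : [set e | _] = [set e | col_charge (e.1, e.2) d]); last first.
  by apply/setP=> -[i j]; rewrite !inE.
apply: (@card_pairs_le _ _ (fun i j => col_charge (i, j) d)) => [i j|i _].
  by case/and5P=> /= _ id _ _ few; rewrite inE few andbT inE.
apply: leq_trans (near_row_le i (ck d)).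
apply/subset_leq_card/fintype.subsetP=> j; rewrite !inE.
by case/and5P=> /= -> _ -> -> _.
Qed.

(** The heart of the count: a crossing with [2s] successors in its row and in its
    column charges [s] ends. *)
Let charged i j : 0 < s -> biclique_free crossing s -> crossing i j ->
  t <= #|[set j' in [set j' | crossing i j'] | ck j < ck j']| ->
  t <= #|[set i' in [set i' | crossing i' j] | rk i < rk i']| ->
  s <= #|[set u | row_charge (i, j) u]| \/ s <= #|[set d | col_charge (i, j) d]|.
Proof.
move=> s0 free cij rowt colt.
pose S := [set j' | crossing i j' & ck j <= ck j'].
have tS : 0 < t <= #|S|.
  rewrite /t muln_gt0 s0 /=; apply: leq_trans rowt _.
  by apply/subset_leq_card/fintype.subsetP=> j'; rewrite !inE => /andP[-> /ltnW].
have [b bS bW] := first_block ck_inj tS; set W := [set y in S | _] in bW.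
have jb : ck j <= ck b by move: bS; rewrite inE => /andP[].
have cib : crossing i b by move: bS; rewrite inE => /andP[].
have jW : j \in W by rewrite !inE cij leqnn jb.
(* the rows above [i] that meet the strip of the next [2s] columns *)
pose Rel := [set i' | [&& rk i < rk i', lo i' <= ck b & ck j <= hi i']].
have tR : 0 < t <= #|Rel|.
  rewrite /t muln_gt0 s0 /=; apply: leq_trans colt _.
  apply/subset_leq_card/fintype.subsetP=> i'; rewrite !inE => /andP[].
  by case/andP=> /andP[l -> _] ->; rewrite (leq_trans l jb).
have [c cR cT] := first_block rk_inj tR; set T := [set y in Rel | _] in cT.
have cinT : c \in T by rewrite inE cR leqnn.
(* the rows that span the strip, and the columns that reach the last of the rows *)
pose F := [set y in T | lo y <= ck j & ck b <= hi y].
pose D := [set y in W | rk c <= hi' y].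
have near m : m <= ck b -> near_row (i, j) m.
  move=> mb; rewrite /near_row -bW (cardsD1 j W) jW ltnS.
  apply/subset_leq_card/fintype.subsetP=> y; rewrite !inE /= => /andP[/andP[-> ym] jy].
  by rewrite (ltnW jy) (leq_trans ym mb) !andbT; apply: contraTneq jy => ->; rewrite ltnn.
have rest (U : finType) (X Y : {set U}) : #|X| = t -> #|Y| < s -> s <= #|X :\: Y|.
  by rewrite cardsD => -> Ys; have := subset_leq_card (subsetIr X Y); lia.
have [sF|Fs] := leqP s #|F|; last first.
  (* a row that does not span the strip has an end in it, the left one if possible *)
  left; pose g A := (A, ck j < lo A).
  have g_inj : injective g by move=> x y [].
  apply: leq_trans (rest _ _ _ cT Fs) _; rewrite -(card_imset _ g_inj).
  apply/subset_leq_card/fintype.subsetP=> _ /imsetP[A AT ->].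
  move: AT; rewrite !inE => /andP[AF /andP[/and3P[iA lA hA] Ac]].
  rewrite iA lA hA Ac /= in AF.
  have [jm mb] : ck j <= row_end (g A) /\ row_end (g A) <= ck b.
    rewrite /row_end /=; case: ltnP => jl /=; first by rewrite ltnW.
    by move: AF; rewrite jl /= -ltnNge => /ltnW.
  have mi : row_end (g A) <= hi i.
    by apply: leq_trans mb _; case/andP: cib => /andP[].
  rewrite /row_charge /= cij iA jm mi near //= -cT (cardsD1 A T).
  rewrite !inE iA lA hA Ac /= ltnS.
  apply/subset_leq_card/fintype.subsetP=> y; rewrite !inE => /andP[/andP[yA /andP[ly hy]] iy].
  rewrite iy (leq_trans ly mb) (leq_trans jm hy) (ltnW (leq_trans yA Ac)) !andbT.
  by apply: contraTneq yA => ->; rewrite ltnn.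
have [sD|Ds] := leqP s #|D|; last first.
  right; apply: leq_trans (rest _ _ _ bW Ds) _.
  apply/subset_leq_card/fintype.subsetP=> d; rewrite !inE => /andP[dD /andP[/andP[cid jd] db]].
  rewrite cid jd db /= -ltnNge in dD.
  rewrite /col_charge /= cij cid jd near //= -cT (cardsD1 c T) cinT ltnS.
  apply/subset_leq_card/fintype.subsetP=> y; rewrite !inE => /andP[/andP[/andP[ly hy] /andP[_ yh]] iy].
  have yc : rk y < rk c by apply: leq_ltn_trans dD.
  rewrite iy (leq_trans ly db) (leq_trans jd hy) (ltnW yc) !andbT.
  by apply: contraTneq yc => ->; rewrite ltnn.
case: (free F D sF sD) => A d; rewrite !inE.
move=> /andP[/andP[/and3P[iA _ _] Ac] /andP[lA hA]] /andP[/andP[/andP[cid jd] db] dc].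
rewrite /crossing (leq_trans lA jd) (leq_trans db hA) (leq_trans Ac dc) /= andbT.
by apply: leq_trans (ltnW iA); case/andP: cid => _ /andP[].
Qed.

(** Every crossing is among the last [2s] of its row, or among the last [2s] of
    its column, or charges [s] ends of rows or [s] ends of columns. *)
Theorem crossing_bound : 0 < s -> biclique_free crossing s ->
  #|[set e | crossing e.1 e.2]| <= s * (10 * #|I| + 6 * #|J|).
Proof.
move=> s0 free.
pose X := [set e | crossing e.1 e.2].
pose XI := [set e : I * J | crossing e.1 e.2 &
  #|[set j' in [set j' | crossing e.1 j'] | ck e.2 < ck j']| < t].
pose XJ := [set e : I * J | crossing e.1 e.2 &
  #|[set i' in [set i' | crossing i' e.2] | rk e.1 < rk i']| < t].
pose XP := [set e in X | s <= #|[set u | row_charge e u]|].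
pose XD := [set e in X | s <= #|[set d | col_charge e d]|].
have cover : X \subset XI :|: XJ :|: XP :|: XD.
  apply/fintype.subsetP=> -[i j]; rewrite !inE /= => cij; rewrite cij /=.
  case: ltnP => //= rowt; case: ltnP => //= colt.
  by have [-> | ->] := charged s0 free cij rowt colt; rewrite ?orbT.
have cI : #|XI| <= t * #|I| by apply: last_in_row.
have cJ : #|XJ| <= t * #|J| by apply: last_in_column.
have cP : s * #|XP| <= t * t * #|{: I * bool}|.
  apply: (@double_count _ _ _ row_charge) => [e|u]; first by rewrite inE => /andP[].
  apply: leq_trans (row_charge_le u).
  by apply/subset_leq_card/fintype.subsetP=> e; rewrite !inE => /andP[].
have cD : s * #|XD| <= t * t * #|J|.
  apply: (@double_count _ _ _ col_charge) => [e|u]; first by rewrite inE => /andP[].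
  apply: leq_trans (col_charge_le u).
  by apply/subset_leq_card/fintype.subsetP=> e; rewrite !inE => /andP[].
rewrite card_prod card_bool in cP.
have {}cP : #|XP| <= 8 * s * #|I|.
  by rewrite -(leq_pmul2l s0); apply: leq_trans cP _; rewrite /t; nia.
have {}cD : #|XD| <= 4 * s * #|J|.
  by rewrite -(leq_pmul2l s0); apply: leq_trans cD _; rewrite /t; nia.
apply: leq_trans (subset_leq_card cover) _.
apply: leq_trans (leq_card_setU _ _) _.
apply: leq_trans (leq_add (leq_card_setU _ _) (leqnn _)) _.
apply: leq_trans (leq_add (leq_add (leq_card_setU _ _) (leqnn _)) (leqnn _)) _.
rewrite /t in cI cJ; nia.
Qed.
End Segments.

(** The pair [(1, 0)] encodes the empty range. *)
Lemma span_key (T : finType) (key : T -> nat) (P : pred T) :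
  exists lohi : nat * nat, forall m,
    (lohi.1 <= m <= lohi.2) <->
    (exists2 x, P x & key x <= m) /\ (exists2 x, P x & m <= key x).
Proof.
have [x0 Px0|noP] := pickP P.
  case: (arg_minnP key Px0) => a Pa amin; case: (arg_maxnP key Px0) => b Pb bmax.
  exists (key a, key b) => m /=; split=> [/andP[am mb]|]; first by split; [exists a|exists b].
  case=> -[x Px xm] [y Py my].
  by rewrite (leq_trans (amin x Px) xm) (leq_trans my (bmax y Py)).
exists (1, 0) => m; split=> [/andP /= [] *|[] [x]]; last by rewrite noP.
by lia.
Qed.

(** Replacing each row and each column by the range that its entries span turns
    the relation into a crossing pattern of segments. *)
Theorem biconvex_bound (I J : finType) (rk : I -> nat) (ck : J -> nat)
    (E : I -> J -> bool) s :
  injective rk -> injective ck -> 0 < s ->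
  (forall i j, (exists2 j1, E i j1 & ck j1 <= ck j) -> (exists2 j2, E i j2 & ck j <= ck j2) ->
     (exists2 i1, E i1 j & rk i1 <= rk i) -> (exists2 i2, E i2 j & rk i <= rk i2) -> E i j) ->
  biclique_free E s ->
  #|[set e | E e.1 e.2]| <= s * (10 * #|I| + 6 * #|J|).
Proof.
move=> rk_inj ck_inj s0 closed free.
have [lh Hlh] := fin_all_exists (fun i => span_key ck (E i)).
have [lh' Hlh'] := fin_all_exists (fun j => span_key rk (E^~ j)).
pose X := crossing rk ck (fun i => (lh i).1) (fun i => (lh i).2)
                (fun j => (lh' j).1) (fun j => (lh' j).2).
have EX i j : E i j = X i j.
  apply/idP/andP => [Eij | [/Hlh[l r] /Hlh'[b u]]]; last exact: closed.
  by split; [apply/Hlh; split; exists j | apply/Hlh'; split; exists i].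
rewrite (_ : [set e | _] = [set e | X e.1 e.2]); last by apply/setP=> e; rewrite !inE EX.
apply: crossing_bound => // A B sA sB AB; apply: (free A B) => // i j iA jB.
by rewrite EX; apply: AB.
Qed.

(** * Ordered graphs *)

Section Ordered.
Variables (V : finType) (key : V -> nat) (s : nat).
Hypotheses (key_inj : injective key) (s_gt0 : 0 < s).

(** An edge [ac] that is neither among the [s] longest edges of [F] leaving [a]
    nor among the [s] longest arriving at [c] comes with [s] edges [xc] starting
    before [a] and [s] edges [ay] ending after [c].  They cross pairwise, so that
    all the [xy] are edges.  Keeping the crossing edges in a smaller
    relation [F] lets the same argument serve for one part of the edges. *)
Lemma capped_bound (E F : V -> V -> bool) :
  (forall x y, F x y -> key x < key y) ->
  (forall a b c d, key a < key b -> key b < key c -> key c < key d ->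
     F a c -> F b d -> E a d) ->
  biclique_free E s -> #|[set e | F e.1 e.2]| <= s * (2 * #|V|).
Proof.
move=> Flt cap free.
pose XR := [set e : V * V | F e.1 e.2 & #|[set y in [set y | F e.1 y] | key e.2 < key y]| < s].
pose XL := [set e : V * V | F e.1 e.2 & #|[set x in [set x | F x e.2] | key x < key e.1]| < s].
have cover : [set e | F e.1 e.2] \subset XR :|: XL.
  apply/fintype.subsetP=> -[a c]; rewrite !inE /= => Fac; rewrite Fac /=.
  case: ltnP => //= sR; case: ltnP => //= sL; case: (free _ _ sL sR) => x y.
  rewrite !inE => /andP[Fxc xa] /andP[Fay cy].
  exact: (cap x a c y xa (Flt _ _ Fac) cy).
have cR : #|XR| <= s * #|V| by apply: last_in_row.
have cL : #|XL| <= s * #|V|.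
  rewrite /XL (card_swap (fun a c => F a c &&
    (#|[set x in [set x | F x c] | key x < key a]| < s))).
  rewrite -cardsT; apply: (@card_pairs_le _ _ (fun c a => F a c &&
    (#|[set x in [set x | F x c] | key x < key a]| < s))) => // j _.
  apply: leq_trans (few_first [set x | F x j] s key_inj).
  by apply/subset_leq_card/fintype.subsetP=> i; rewrite !inE.
apply: leq_trans (subset_leq_card cover) (leq_trans (leq_card_setU _ _) _).
by rewrite mul2n -addnn mulnDr leq_add.
Qed.

Variable E : V -> V -> bool.
Hypothesis E_lt : forall x y, E x y -> key x < key y.
Hypothesis E_cap : forall a b c d p q,
  key a < key b -> key b < key c -> key c < key d -> E a c -> E b d ->
  E p q -> key p <= key a -> key d <= key q -> E a d.

(** The successor [m.+1] keeps the cuts increasing where no edge passes. *)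
Let reach m := maxn m.+1 (\max_(p | key p <= m) \max_(q | E p q) key q).
Let brk k := iter k reach 0.

Let brk_ltS k : brk k < brk k.+1.
Proof. by rewrite /brk iterS leq_max leqnn. Qed.

Let brk_le k l : k <= l -> brk k <= brk l.
Proof.
move=> /subnKC <-; elim: (l - k) => [|n IH]; first by rewrite addn0.
by rewrite addnS (leq_trans IH) // ltnW.
Qed.

Let brk_ge k : k <= brk k.
Proof. by elim: k => // k IH; apply: leq_ltn_trans IH (brk_ltS k). Qed.

Let brk_lt k l : brk k < brk l -> k < l.
Proof. by apply: contraTltn => /brk_le; rewrite -leqNgt. Qed.

Let slab_ex m : exists k, brk k <= m < brk k.+1.
Proof.
have P0 : exists k, brk k <= m by exists 0.
have bounded k : brk k <= m -> k <= m by apply: leq_trans (brk_ge k).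
case: (ex_maxnP P0 bounded) => k km kmax; exists k; rewrite km /= ltnNge.
by apply/negP => le; have := kmax k.+1 le; rewrite ltnn.
Qed.

Let slab m := xchoose (slab_ex m).

Let slabP m : brk (slab m) <= m < brk (slab m).+1.
Proof. exact: xchooseP (slab_ex m). Qed.

Let reach_ge p q m : key p <= m -> E p q -> key q <= reach m.
Proof.
move=> pm Epq; rewrite leq_max; apply/orP; right.
apply: leq_trans (leq_bigmax_cond _ pm).
exact: (leq_bigmax_cond _ Epq).
Qed.

Let reach_attained m : m.+1 < reach m ->
  exists p q, [/\ key p <= m, E p q & reach m = key q].
Proof.
rewrite /reach; set M := \max_(p | _) _ => lt.
have -> : maxn m.+1 M = M by apply/maxn_idPr; lia.
have M0 : 0 < M by lia.
have := M0; rewrite {1}/M; case: (pickP (fun p => key p <= m)) => [p0 p0m | no]; last by rewrite big_pred0.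
have [p pm Mp] : {p | key p <= m & M = \max_(q | E p q) key q}.
  by apply: eq_bigmax_cond; apply/card_gt0P; exists p0.
move=> _; case: (pickP (E p)) => [q0 Epq0 | no]; last by move: M0; rewrite Mp big_pred0.
have [q Epq Mq] : {q | E p q & \max_(q | E p q) key q = key q}.
  by apply: eq_bigmax_cond; apply/card_gt0P; exists q0.
by exists p, q; rewrite Mp.
Qed.

(** [F0] collects the edges that stay within one slab between consecutive cuts,
    [F1] those that leave it; the latter end in the next slab. *)
Theorem ordered_bound : biclique_free E s ->
  #|[set e | E e.1 e.2]| <= s * (18 * #|V|).
Proof.
move=> free.
pose F0 x y := E x y && (key y <= brk (slab (key x)).+1).
pose F1 x y := E x y && (brk (slab (key x)).+1 < key y).
have F0E x y : F0 x y -> E x y by case/andP.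
have F1E x y : F1 x y -> E x y by case/andP.
have bound0 : #|[set e | F0 e.1 e.2]| <= s * (2 * #|V|).
  apply: (capped_bound (E := E)) => // [x y /F0E/E_lt //|a b c d ab bc cd].
  case/andP=> Eac ci /andP[Ebd di].
  have /andP[ia ai] := slabP (key a); have /andP[ib bi] := slabP (key b).
  have eqi : slab (key b) = slab (key a).
    apply/eqP; rewrite eqn_leq; apply/andP; split.
      by rewrite -ltnS; apply: brk_lt; apply: leq_ltn_trans ib (leq_trans bc ci).
    by rewrite -ltnS; apply: brk_lt; apply: leq_ltn_trans ia (ltn_trans ab bi).
  rewrite eqi in di ib bi.
  (* the slab holds two keys, so its end was reached by an edge, which covers it *)
  have far : (brk (slab (key a))).+1 < brk (slab (key a)).+1 by lia.
  have [p [q [pm Epq rq]]] := reach_attained far.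
  apply: (E_cap ab bc cd Eac Ebd Epq (leq_trans pm ia)).
  by rewrite -rq.
have bound1 : #|[set e | F1 e.1 e.2]| <= s * (10 * #|V| + 6 * #|V|).
  apply: (biconvex_bound key_inj key_inj) => //; last first.
    by move=> A B sA sB AB; apply: (free A B) => // i j iA jB; apply/F1E/AB.
  move=> x y [z xz zy] [z' xz' yz'] [w' w'y w'x] [w wy xw].
  have yi : brk (slab (key x)).+1 < key y by case/andP: xz => _ /leq_trans; apply.
  rewrite /F1 yi andbT.
  have [/key_inj <- | ltzy] := eqVneq (key z) (key y); first exact: F1E.
  have [/key_inj -> | ltxw] := eqVneq (key x) (key w); first exact: F1E.
  have /andP[ix xi] := slabP (key x); have /andP[iw wi] := slabP (key w).
  have z'r : key z' <= brk (slab (key x)).+2.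
    by apply: reach_ge (F1E _ _ xz'); apply: ltnW.
  have eqi : slab (key w) <= slab (key x).
    rewrite -ltnS -ltnS; apply: brk_lt; case/andP: wy => _ lt.
    exact: leq_trans lt (leq_trans yz' z'r).
  (* [w] lies before the cut and [z] after it: the two edges cross *)
  have wz : key w < key z.
    apply: (leq_trans wi); case/andP: xz => _ lt; apply: leq_trans (ltnW lt).
    by apply: brk_le.
  apply: (E_cap _ wz _ (F1E _ _ xz) (F1E _ _ wy) (F1E _ _ w'y)) => //; last 2 first.
  - by rewrite ltn_neqAle ltxw.
  - by rewrite ltn_neqAle ltzy.
have cover : [set e | E e.1 e.2] \subset [set e | F0 e.1 e.2] :|: [set e | F1 e.1 e.2].
  by apply/fintype.subsetP=> e; rewrite !inE /F0 /F1 => ->; case: leqP.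
apply: leq_trans (subset_leq_card cover) (leq_trans (leq_card_setU _ _) _).
by apply: leq_trans (leq_add bound0 bound1) _; nia.
Qed.

End Ordered.

Local Open Scope ring_scope.

(** Ties are broken arbitrarily, so that coordinates that may coincide still
    yield an injective key. *)
Lemma rank_key (R : realDomainType) (V : finType) (f : V -> R) :
  exists2 key : V -> nat, injective key & forall v w, (key v <= key w)%N -> f v <= f w.
Proof.
pose le := relpre f <=%R.
have le_total : total le by move=> x y; apply: le_total.
have le_trans : transitive le by move=> y x z; apply: le_trans.
pose e := sort le (enum V).
have in_e v : v \in e by rewrite mem_sort mem_enum.
exists (index^~ e) => [v w vw|v w vw]; first exact: (index_inj v (in_e v) (in_e w) vw).
have refl : reflexive le by move=> x; apply: lexx.
have := sorted_leq_nth le_trans refl v (sort_sorted le_total (enum V)) (index v e) (index w e).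
by rewrite !inE !nth_index //= => -> //; rewrite ?index_mem ?inE.
Qed.

Lemma rank_lt (R : realDomainType) (V : finType) (f : V -> R) (key : V -> nat) :
  (forall v w, (key v <= key w)%N -> f v <= f w) ->
  forall v w, f v < f w -> (key v < key w)%N.
Proof. by move=> H v w; rewrite ltnNge; apply: contraTN => /H; rewrite -leNgt. Qed.

(** * Sight lines under a roof and above a floor *)

Section Sight.
Variable R : realFieldType.
Implicit Types (p q z : R * R) (Reg : R * R -> Prop).

Definition sees Reg p q := forall t, 0 <= t <= 1 ->
  Reg ((1 - t) * p.1 + t * q.1, (1 - t) * p.2 + t * q.2).

Lemma sees_l Reg p q : sees Reg p q -> Reg p.
Proof.
move/(_ 0); rewrite lexx ler01 subr0 !mul0r !addr0 !mul1r => /(_ isT).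
by case: p.
Qed.

Lemma sees_r Reg p q : sees Reg p q -> Reg q.
Proof.
move/(_ 1); rewrite lexx ler01 subrr !mul0r !add0r !mul1r => /(_ isT).
by case: q.
Qed.

Lemma sees_sym Reg p q : sees Reg p q -> sees Reg q p.
Proof.
move=> see t t01; have := see (1 - t); rewrite subr_ge0 gerBl andbC => /(_ t01).
by congr Reg; congr (_, _); ring.
Qed.

(** Positive when [z] lies to the left of the line from [p] to [q]; for
    [p.1 < q.1] this means above it. *)
Definition orient p q z := (q.1 - p.1) * (z.2 - p.2) - (q.2 - p.2) * (z.1 - p.1).

Definition vconvex Reg := forall x y1 y y2, y1 <= y <= y2 ->
  Reg (x, y1) -> Reg (x, y2) -> Reg (x, y).
Definition upper Reg p := forall y, p.2 < y -> ~ Reg (p.1, y).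
Definition lower Reg p := forall y, y < p.2 -> ~ Reg (p.1, y).

Lemma sees_at Reg p q z : p.1 < q.1 -> sees Reg p q -> p.1 <= z.1 <= q.1 ->
  exists2 y, Reg (z.1, y) & (q.1 - p.1) * (y - z.2) = - orient p q z.
Proof.
move=> pq see /andP[pz zq].
have pq0 : q.1 - p.1 != 0 by rewrite gt_eqF // subr_gt0.
pose t := (z.1 - p.1) / (q.1 - p.1).
have t01 : 0 <= t <= 1.
  by rewrite divr_ge0 ?ler_pdivrMr ?subr_ge0 ?subr_gt0 ?(ltW pq) //=; lra.
exists ((1 - t) * p.2 + t * q.2).
  have -> : z.1 = (1 - t) * p.1 + t * q.1 by rewrite /t; field.
  exact: see.
by rewrite /orient /t; field.
Qed.

(** The device by which all visibilities of this part are proved: a point that is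
    below one sight line and above another belongs to a vertically convex
    region. *)
Lemma sandwich Reg p q p' q' z : vconvex Reg ->
  p.1 < q.1 -> p'.1 < q'.1 -> sees Reg p q -> sees Reg p' q' ->
  p.1 <= z.1 <= q.1 -> p'.1 <= z.1 <= q'.1 ->
  orient p q z <= 0 -> 0 <= orient p' q' z -> Reg z.
Proof.
move=> vc pq pq' see see' rz rz' below above.
have [y Ry] := sees_at pq see rz; have [y' Ry'] := sees_at pq' see' rz'.
case: z {rz rz'} below above Ry Ry' => x z /= below above Ry Ry' ey' ey.
apply: (vc _ y' _ y) => //; apply/andP; split.
  by rewrite -subr_le0 -(pmulr_rle0 _ (_ : 0 < q'.1 - p'.1)) ?subr_gt0 // ey' oppr_le0.
by rewrite -subr_ge0 -(pmulr_rge0 _ (_ : 0 < q.1 - p.1)) ?subr_gt0 // ey oppr_ge0.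
Qed.

Lemma upper_orient Reg p q a : p.1 < q.1 -> sees Reg p q -> p.1 <= a.1 <= q.1 ->
  upper Reg a -> 0 <= orient p q a.
Proof.
move=> pq see ra top; have [y Ry ey] := sees_at pq see ra.
rewrite leNgt; apply/negP => neg; apply: (top y) => //.
by rewrite -subr_gt0 -(pmulr_rgt0 _ (_ : 0 < q.1 - p.1)) ?subr_gt0 // ey oppr_gt0.
Qed.

Lemma lower_orient Reg p q a : p.1 < q.1 -> sees Reg p q -> p.1 <= a.1 <= q.1 ->
  lower Reg a -> orient p q a <= 0.
Proof.
move=> pq see ra top; have [y Ry ey] := sees_at pq see ra.
rewrite leNgt; apply/negP => neg; apply: (top y) => //.
by rewrite -subr_lt0 -(pmulr_rlt0 _ (_ : 0 < q.1 - p.1)) ?subr_gt0 // ey oppr_lt0.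
Qed.

Let at_ p q (t : R) : R * R := ((1 - t) * p.1 + t * q.1, (1 - t) * p.2 + t * q.2).

Lemma orient_at p q a d t : orient p q (at_ a d t) = (1 - t) * orient p q a + t * orient p q d.
Proof. by rewrite /orient /=; ring. Qed.

Lemma at_range a d t : a.1 <= d.1 -> 0 <= t <= 1 -> a.1 <= (at_ a d t).1 <= d.1.
Proof. by move=> ad /andP[t0 t1] /=; apply/andP; split; nra. Qed.

(** Since [b] is above [ac] and [c] above [bd], both are above [ad]: over
    [[a, c]] the line [ac], and over [[b, d]] the line [bd], lies above [ad].  The
    covering line [pq] is below [a] and [d], hence below [ad]. *)
Lemma upper_crossing Reg a b c d p q : vconvex Reg ->
  upper Reg a -> upper Reg b -> upper Reg c -> upper Reg d ->
  a.1 < b.1 -> b.1 < c.1 -> c.1 < d.1 ->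
  sees Reg a c -> sees Reg b d -> sees Reg p q -> p.1 <= a.1 -> d.1 <= q.1 ->
  sees Reg a d.
Proof.
move=> vc ua ub uc ud ab bc cd sac sbd spq pa dq t t01.
have abc : 0 <= orient a c b by apply: upper_orient sac _ ub; lra.
have bcd : 0 <= orient b d c by apply: upper_orient sbd _ uc; lra.
have pqa : 0 <= orient p q a by apply: upper_orient spq _ ua; lra.
have pqd : 0 <= orient p q d by apply: upper_orient spq _ ud; lra.
have acd : orient a c d <= 0.
  rewrite -(pmulr_rle0 _ (_ : 0 < c.1 - b.1)) ?subr_gt0 //.
  have -> : (c.1 - b.1) * orient a c d = - (orient b d c * (c.1 - a.1) + orient a c b * (d.1 - c.1)).
    by rewrite /orient; ring.
  by rewrite oppr_le0 addr_ge0 ?mulr_ge0 //; lra.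
have bda : orient b d a <= 0.
  rewrite -(pmulr_rle0 _ (_ : 0 < c.1 - b.1)) ?subr_gt0 //.
  have -> : (c.1 - b.1) * orient b d a = - (orient b d c * (b.1 - a.1) + orient a c b * (d.1 - b.1)).
    by rewrite /orient; ring.
  by rewrite oppr_le0 addr_ge0 ?mulr_ge0 //; lra.
rewrite -/(at_ a d t).
have /andP[az zd] : a.1 <= (at_ a d t).1 <= d.1 by apply: at_range; lra.
have above : 0 <= orient p q (at_ a d t).
  by rewrite orient_at addr_ge0 ?mulr_ge0 //; lra.
have [zc|cz] := leP (at_ a d t).1 c.1.
  apply: (@sandwich Reg a c p q) => //; try lra.
  by rewrite orient_at {1}/orient; nra.
apply: (@sandwich Reg b d p q) => //; try lra.
by rewrite orient_at {2}/orient; nra.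
Qed.

(** The line [aq] passes above [c] and the line [pc] below [a], so that [ac] lies
    between them. *)
Lemma upper_lower_outer Reg a c p q : vconvex Reg ->
  upper Reg a -> lower Reg c -> a.1 < c.1 ->
  sees Reg a q -> sees Reg p c -> c.1 <= q.1 -> p.1 <= a.1 -> sees Reg a c.
Proof.
move=> vc ua lc ac saq spc cq pa t t01; rewrite -/(at_ a c t).
have /andP[az zd] : a.1 <= (at_ a c t).1 <= c.1 by apply: at_range; lra.
have aqc : orient a q c <= 0 by apply: lower_orient saq _ lc; lra.
have pca : 0 <= orient p c a by apply: upper_orient spc _ ua; lra.
apply: (@sandwich Reg a q p c) => //; try lra.
  by rewrite orient_at {1}/orient; nra.
by rewrite orient_at {2}/orient; nra.
Qed.

Section Counting.
Variables (V : finType) (pos : V -> R * R) (Reg : R * R -> Prop) (s : nat).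
Hypotheses (s_gt0 : (0 < s)%N).
Variable E : V -> V -> bool.

Lemma upper_upper_bound : injective pos -> vconvex Reg ->
  (forall x y, E x y <-> [/\ upper Reg (pos x), upper Reg (pos y),
                            (pos x).1 < (pos y).1 & sees Reg (pos x) (pos y)]) ->
  biclique_free E s -> (#|[set e | E e.1 e.2]| <= s * (18 * #|V|))%N.
Proof.
move=> pos_inj vc EP; have [key key_inj keyle] := rank_key (fun v => (pos v).1).
have keylt := rank_lt keyle.
apply: (ordered_bound key_inj) => // [x y /EP[_ _ /keylt //]|].
have strict x y : upper Reg (pos x) -> upper Reg (pos y) -> Reg (pos x) -> Reg (pos y) ->
    (key x < key y)%N -> (pos x).1 < (pos y).1.
  move=> ux uy Rx Ry xy; rewrite lt_neqAle keyle ?(ltnW xy) // andbT.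
  apply/eqP => e1; suff /pos_inj exy : pos x = pos y by rewrite exy ltnn in xy.
  rewrite [LHS]surjective_pairing [RHS]surjective_pairing e1; congr (_, _).
  apply/eqP; rewrite eq_le !leNgt; apply/andP; split; apply/negP.
    by move/uy; apply; rewrite -e1 -surjective_pairing.
  by move/ux; apply; rewrite e1 -surjective_pairing.
move=> a b c d p q ab bc cd /EP[ua uc _ sac] /EP[ub ud _ sbd] /EP[_ _ _ spq] pa dq.
have Ra := sees_l sac; have Rb := sees_l sbd; have Rc := sees_r sac; have Rd := sees_r sbd.
have ltab := strict _ _ ua ub Ra Rb ab; have ltbc := strict _ _ ub uc Rb Rc bc.
have ltcd := strict _ _ uc ud Rc Rd cd.
apply/EP; split=> //; first by rewrite (lt_trans ltab) // (lt_trans ltbc).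
exact: (upper_crossing vc ua ub uc ud ltab ltbc ltcd sac sbd spq (keyle _ _ pa) (keyle _ _ dq)).
Qed.

Lemma upper_lower_bound : vconvex Reg ->
  (forall x y, E x y <-> [/\ upper Reg (pos x), lower Reg (pos y),
                            (pos x).1 < (pos y).1 & sees Reg (pos x) (pos y)]) ->
  biclique_free E s -> (#|[set e | E e.1 e.2]| <= s * (16 * #|V|))%N.
Proof.
move=> vc EP free; have [key key_inj keyle] := rank_key (fun v => (pos v).1).
rewrite (_ : 16 * #|V| = 10 * #|V| + 6 * #|V|)%N; last by lia.
apply: (biconvex_bound key_inj key_inj) => // x y.
case=> y1 /EP[ux _ xy1 _] /keyle y1y [y2 /EP[_ _ _ sxy2] /keyle yy2].
case=> x1 /EP[_ ly _ sx1y] /keyle x1x _.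
have xy := lt_le_trans xy1 y1y.
by apply/EP; split=> //; apply: (upper_lower_outer vc ux ly xy sxy2 sx1y).
Qed.
End Counting.
End Sight.

(** * Sight lines around a centre *)

Section StarSight.
Variable R : realFieldType.
Implicit Types (p q z : R * R) (Reg : R * R -> Prop).

(** Positive when the ray of [q] is reached from that of [p] by a counterclockwise
    rotation of less than a half turn. *)
Definition wedge p q := p.1 * q.2 - p.2 * q.1.
Definition star_like Reg := forall z t, 0 <= t <= 1 -> Reg z -> Reg (t * z.1, t * z.2).
Definition tip Reg p := forall t, 1 < t -> ~ Reg (t * p.1, t * p.2).

(** The ray of [b] meets the segment [pq] at [b] multiplied by
    [wedge p q / (wedge p b + wedge b q)], which therefore is at most [1]. *)
Lemma tip_wedge Reg p q b : sees Reg p q -> tip Reg b -> 0 < wedge p b -> 0 < wedge b q ->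
  wedge p q <= wedge p b + wedge b q.
Proof.
move=> see tb pb bq; rewrite leNgt; apply/negP => lt.
have S0 : 0 < wedge p b + wedge b q by apply: addr_gt0.
apply: (tb (wedge p q / (wedge p b + wedge b q))); first by rewrite ltr_pdivlMr ?mul1r.
pose t := wedge p b / (wedge p b + wedge b q).
have t01 : 0 <= t <= 1.
  by rewrite /t divr_ge0 ?ler_pdivrMr ?mul1r ?(ltW pb) ?(ltW S0) //=; lra.
have := see t t01; congr Reg; have := lt0r_neq0 S0; rewrite /t /wedge => nz.
by congr (_, _); field.
Qed.

(** The last hypothesis says that [z] is on the near side of the line [pq], as
    seen from the origin. *)
Lemma shadow Reg p q z : star_like Reg -> sees Reg p q -> 0 < wedge p q ->
  0 <= wedge p z -> 0 <= wedge z q -> wedge p z + wedge z q <= wedge p q -> Reg z.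
Proof.
move=> star see pq pz zq le.
have [S0|S0] := eqVneq (wedge p z + wedge z q) 0.
  have e1 : wedge p z = 0 by lra.
  have e2 : wedge z q = 0 by lra.
  have := star p 0 _ (sees_l see); rewrite lexx ler01 => /(_ isT); congr Reg.
  rewrite [RHS]surjective_pairing !mul0r; congr (_, _); apply: (mulfI (lt0r_neq0 pq)).
    have -> : wedge p q * z.1 = wedge z q * p.1 + wedge p z * q.1 by rewrite /wedge; ring.
    by rewrite e1 e2; ring.
  have -> : wedge p q * z.2 = wedge z q * p.2 + wedge p z * q.2 by rewrite /wedge; ring.
  by rewrite e1 e2; ring.
have Sgt0 : 0 < wedge p z + wedge z q by rewrite lt_neqAle eq_sym S0 addr_ge0.
pose t := wedge p z / (wedge p z + wedge z q).
have t01 : 0 <= t <= 1 by rewrite /t divr_ge0 ?ler_pdivrMr ?mul1r ?(ltW Sgt0) //=; lra.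
have r01 : 0 <= (wedge p z + wedge z q) / wedge p q <= 1.
  by rewrite divr_ge0 ?ler_pdivrMr ?mul1r ?(ltW Sgt0) ?(ltW pq) //=.
have := star _ _ r01 (see t t01); congr Reg.
have := lt0r_neq0 pq; rewrite [RHS]surjective_pairing /t /=.
move: S0; rewrite /wedge => n1 n2.
by congr (_, _); field; rewrite n1 n2.
Qed.

(** As for the roof of an x-monotone region, [b] and [c] lie beyond the line [ad];
    the part of [ad] in the cone of [a] and [c] is in the shadow of [ac], and the
    rest in that of [bd]. *)
Lemma star_crossing Reg a b c d : star_like Reg -> tip Reg b -> tip Reg c ->
  0 < wedge a b -> 0 < wedge b c -> 0 < wedge c d -> 0 < wedge a c -> 0 < wedge b d -> 0 < wedge a d ->
  sees Reg a c -> sees Reg b d -> sees Reg a d.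
Proof.
move=> star tb tc ab bc cd ac bd ad sac sbd t /andP[t0 t1].
have acle := tip_wedge sac tb ab bc; have bdle := tip_wedge sbd tc bc cd.
(* the relation between the wedges of four vectors *)
have plucker : wedge b c * wedge a d = wedge a c * wedge b d - wedge a b * wedge c d.
  by rewrite /wedge; ring.
have acd : wedge a d <= wedge a c + wedge c d.
  rewrite -(ler_pM2l bc) plucker; nra.
have abd : wedge a d <= wedge a b + wedge b d.
  rewrite -(ler_pM2l bc) plucker; nra.
set z := (_, _).
have ez u : wedge u z = (1 - t) * wedge u a + t * wedge u d by rewrite /z /wedge /=; ring.
have ez' u : wedge z u = (1 - t) * wedge a u + t * wedge d u by rewrite /z /wedge /=; ring.
have anti u v : wedge u v = - wedge v u by rewrite /wedge; ring.
have self u : wedge u u = 0 by rewrite /wedge; ring.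
have [zc|cz] := leP 0 (wedge z c).
  apply: (shadow star sac) => //; first by rewrite ez self; nra.
  by rewrite ez ez' self (anti d c); nra.
have cz' : 0 < wedge c z by rewrite anti; lra.
have key : t * wedge c d > (1 - t) * wedge a c.
  by move: cz'; rewrite ez (anti c a); lra.
have bz : 0 <= wedge b z.
  rewrite ez (anti b a).
  rewrite -(pmulr_rge0 _ cd).
  have -> : wedge c d * ((1 - t) * - wedge a b + t * wedge b d) =
      (t * wedge c d - (1 - t) * wedge a c) * wedge b d + (1 - t) * (wedge b c * wedge a d).
    by rewrite plucker; ring.
  by rewrite addr_ge0 ?mulr_ge0 ?(ltW bc) ?(ltW ad) ?(ltW bd) //; lra.
apply: (shadow star sbd) => //; first by rewrite ez' self; nra.
by rewrite ez ez' self (anti b a); nra.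
Qed.

(** The segment passes through the origin. *)
Lemma antipodal_sees Reg p q : star_like Reg -> Reg p -> Reg q ->
  0 < p.2 -> q.2 < 0 -> wedge p q = 0 -> sees Reg p q.
Proof.
move=> star Rp Rq p0 q0 pq t /andP[t0 t1].
have p2 := lt0r_neq0 p0; have q2 : q.2 != 0 by rewrite lt_eqF.
have qE : q.1 = q.2 * p.1 / p.2.
  by apply: (mulIf p2); rewrite divfK //; move: pq; rewrite /wedge; lra.
have pE : p.1 = p.2 * q.1 / q.2.
  by apply: (mulIf q2); rewrite divfK //; move: pq; rewrite /wedge; lra.
have [le|lt] := leP 0 ((1 - t) * p.2 + t * q.2).
  have r01 : 0 <= ((1 - t) * p.2 + t * q.2) / p.2 <= 1.
    by rewrite divr_ge0 ?ler_pdivrMr ?mul1r ?(ltW p0) //=; nra.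
  have := star _ _ r01 Rp; congr Reg; rewrite qE.
  by congr (_, _); field.
have r01 : 0 <= ((1 - t) * p.2 + t * q.2) / q.2 <= 1.
  rewrite -mulrNN -invrN divr_ge0 ?ler_pdivrMr ?mul1r ?oppr_ge0 ?oppr_gt0 ?(ltW lt) ?(ltW q0) //=.
  by rewrite lerN2; nra.
have := star _ _ r01 Rq; congr Reg; rewrite pE.
by congr (_, _); field.
Qed.

(** Each of the two points bounds the other on their common ray. *)
Lemma same_ray Reg p q : tip Reg p -> tip Reg q -> Reg p -> Reg q ->
  0 < p.2 * q.2 -> p.1 / p.2 = q.1 / q.2 -> p = q.
Proof.
have short p' q' : tip Reg p' -> Reg q' -> 0 < p'.2 * q'.2 ->
    p'.1 / p'.2 = q'.1 / q'.2 -> q'.2 / p'.2 <= 1.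
  move=> tp Rq pq slope; rewrite leNgt; apply/negP => lt; apply: (tp _ lt).
  have : p'.2 * q'.2 != 0 by rewrite gt_eqF.
  rewrite mulf_eq0 negb_or => /andP[p0 q0].
  move: Rq; congr Reg; rewrite [LHS]surjective_pairing divfK // -mulrA (mulrC _^-1) slope.
  by rewrite mulrC divfK.
move=> tp tq Rp Rq pq slope.
have qp1 := short _ _ tp Rq pq slope.
have pq1 : p.2 / q.2 <= 1 by apply: short => //; rewrite mulrC.
have : p.2 * q.2 != 0 by rewrite gt_eqF.
rewrite mulf_eq0 negb_or => /andP[p0 q0].
have r1 : q.2 / p.2 = 1.
  apply/eqP; rewrite eq_le qp1 /= -(invrK (_ / _)) invf_div.
  by rewrite invf_ge1 // -(pmulr_lgt0 _ (_ : 0 < q.2 * q.2)); [rewrite mulrA divfK|rewrite -expr2 exprn_even_gt0].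
have e2 : q.2 = p.2 by rewrite -[LHS](divfK p0) r1 mul1r.
rewrite [LHS]surjective_pairing [RHS]surjective_pairing -e2; congr (_, _).
by apply: (mulIf (invr_neq0 q0)); rewrite -slope e2.

Qed.
Section Counting.
Variables (V : finType) (pos : V -> R * R) (Reg : R * R -> Prop) (s : nat).
Hypotheses (s_gt0 : (0 < s)%N) (star : star_like Reg).
Variable E : V -> V -> bool.

Let angle v := - ((pos v).1 / (pos v).2).

Let wedgeE v w : (pos v).2 != 0 -> (pos w).2 != 0 ->
  wedge (pos v) (pos w) = (pos v).2 * (pos w).2 * (angle w - angle v).
Proof. by move=> nv nw; rewrite /wedge /angle; field; rewrite nv nw. Qed.

Let wedge_same v w : 0 < (pos v).2 * (pos w).2 ->
  (0 < wedge (pos v) (pos w)) = (angle v < angle w).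
Proof.
move=> vw; have : (pos v).2 * (pos w).2 != 0 by rewrite gt_eqF.
rewrite mulf_eq0 negb_or => /andP[v0 w0].
by rewrite wedgeE // pmulr_rgt0 ?subr_gt0.
Qed.

Let wedge_opp v w : 0 < (pos v).2 -> (pos w).2 < 0 ->
  (0 < wedge (pos v) (pos w)) = (angle w < angle v).
Proof.
move=> v0 w0; rewrite (wedgeE (lt0r_neq0 v0) (ltr0_neq0 w0)) nmulr_rgt0 ?subr_lt0 //.
by rewrite pmulr_rlt0.
Qed.

Let wedge_opp_ge0 v w : 0 < (pos v).2 -> (pos w).2 < 0 ->
  (0 <= wedge (pos v) (pos w)) = (angle w <= angle v).
Proof.
move=> v0 w0; rewrite (wedgeE (lt0r_neq0 v0) (ltr0_neq0 w0)) nmulr_rge0 ?subr_le0 //.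
by rewrite pmulr_rlt0.
Qed.

(** In an open half-plane [- x / y] orders the rays counterclockwise. *)
Lemma half_plane_bound : injective pos ->
  (forall x y, E x y <-> [/\ 0 < (pos x).2 /\ 0 < (pos y).2, tip Reg (pos x), tip Reg (pos y),
                            0 < wedge (pos x) (pos y) & sees Reg (pos x) (pos y)]) ->
  biclique_free E s -> (#|[set e | E e.1 e.2]| <= s * (18 * #|V|))%N.
Proof.
move=> pos_inj EP; have [key key_inj keyle] := rank_key angle.
have keylt := rank_lt keyle.
apply: (ordered_bound key_inj) => // [x y /EP[[x0 y0] _ _] |].
  by rewrite wedge_same ?mulr_gt0 // => /keylt.
have strict x y : 0 < (pos x).2 -> 0 < (pos y).2 -> tip Reg (pos x) -> tip Reg (pos y) ->
    Reg (pos x) -> Reg (pos y) -> (key x < key y)%N -> angle x < angle y.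
  move=> x0 y0 tx ty Rx Ry xy; rewrite lt_neqAle keyle ?(ltnW xy) // andbT.
  apply/eqP => /oppr_inj exy; suff /pos_inj e : pos x = pos y by rewrite e ltnn in xy.
  by apply: (same_ray tx ty Rx Ry) => //; apply: mulr_gt0.
move=> a b c d p q ab bc cd /EP[[a0 c0] ta tc _ sac] /EP[[b0 d0] tb td _ sbd] _ _ _.
have Ra := sees_l sac; have Rb := sees_l sbd; have Rc := sees_r sac; have Rd := sees_r sbd.
have ltab := strict _ _ a0 b0 ta tb Ra Rb ab; have ltbc := strict _ _ b0 c0 tb tc Rb Rc bc.
have ltcd := strict _ _ c0 d0 tc td Rc Rd cd.
have ltac := lt_trans ltab ltbc; have ltbd := lt_trans ltbc ltcd.
have ltad := lt_trans ltac ltcd.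
apply/EP; split=> //; first by rewrite wedge_same // mulr_gt0.
by apply: (star_crossing star tb tc) sac sbd; rewrite wedge_same // mulr_gt0.
Qed.

(** Both half-planes are ordered by [- x / y], which identifies opposite rays; the
    sign of [wedge] tells on which side of the origin the segment passes. *)
Lemma opposite_bound :
  (forall x y, E x y <-> [/\ 0 < (pos x).2 /\ (pos y).2 < 0, tip Reg (pos x), tip Reg (pos y),
                            0 <= wedge (pos x) (pos y) & sees Reg (pos x) (pos y)]) ->
  biclique_free E s -> (#|[set e | E e.1 e.2]| <= s * (16 * #|V|))%N.
Proof.
move=> EP free; have [key key_inj keyle] := rank_key angle.
rewrite (_ : 16 * #|V| = 10 * #|V| + 6 * #|V|)%N; last by lia.
apply: (biconvex_bound key_inj key_inj) => // x y.
case=> y1 /EP[[x0 y10] tx ty1 _ sxy1] /keyle y1y [y2 /EP[[_ y20] _ _ cxy2 _] /keyle yy2].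
case=> _ _ _ [x2 /EP[[x20 y0] tx2 ty _ sx2y] /keyle xx2].
rewrite wedge_opp_ge0 // in cxy2.
have yx : angle y <= angle x := le_trans yy2 cxy2.
apply/EP; split=> //; first by rewrite wedge_opp_ge0.
have Rx := sees_l sxy1; have Ry := sees_r sx2y.
have Rx2 := sees_l sx2y; have Ry1 := sees_r sxy1.
move: yx; rewrite le_eqVlt => /predU1P[exy | yx].
  by apply: antipodal_sees => //; rewrite (wedgeE (lt0r_neq0 x0) (ltr0_neq0 y0)) exy subrr mulr0.
move: y1y; rewrite le_eqVlt => /predU1P[/oppr_inj ey | y1y].
  by rewrite -(same_ray ty1 ty Ry1 Ry _ ey) // nmulr_rgt0.
move: xx2; rewrite le_eqVlt => /predU1P[/oppr_inj ex | xx2].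
  by rewrite (same_ray tx tx2 Rx Rx2 _ ex) // mulr_gt0.
have y1x := lt_trans y1y yx.
apply: (star_crossing star tx2 ty1) sxy1 sx2y.
- by rewrite wedge_same // mulr_gt0.
- by rewrite wedge_opp // (lt_trans y1x).
- by rewrite wedge_same // nmulr_rgt0.
- by rewrite wedge_opp.
- by rewrite wedge_opp // (lt_trans yx).
- by rewrite wedge_opp.
Qed.
End Counting.
End StarSight.

(** * Closed curves that meet every vertical line at most twice *)

Section Curves.
Local Open Scope classical_set_scope.
Local Open Scope ring_scope.
Variable R : realType.
Implicit Types (K : set (R * R)) (p q : R * R) (f g : R -> R) (a b d l r s t x : R).

Lemma same_sign f x a b l l' : continuous f ->
  (forall r, a <= r <= b -> f r != x) ->
  a <= l <= b -> a <= l' <= b -> x < f l -> x < f l'.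
Proof.
move=> cf nz lab l'ab xl; rewrite ltNge; apply/negP => l'x.
have [r] : exists2 r, r \in `[Num.min l l', Num.max l l'] & f r = x.
  apply: IVT; first by case: (leP l l') => // /ltW.
    exact: continuous_subspaceT.
  by case: (leP l l') => _; [rewrite ge_min le_max|rewrite ge_min le_max]; rewrite l'x (ltW xl) ?orbT.
rewrite in_itv /= => rab fr; move: (nz r); rewrite fr eqxx => /(_ _)/implyP.
by move: rab lab l'ab; case: (leP l l') => _ /andP[? ?] /andP[? ?] /andP[? ?]; lra.
Qed.

(** Both functions are followed along a parameter: [f] is the abscissa, [g] the
    height.  An arc that starts to the right of its starting point meets every
    vertical line slightly to the right, near the height where it starts. *)
Lemma one_sided_hits f g d : continuous f -> continuous g -> 0 < d ->
  (forall l, 0 < l < 1 -> f 0 < f l) ->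
  exists2 e, 0 < e & forall x, f 0 < x < f 0 + e ->
    exists l, [/\ 0 <= l <= 1, f l = x & `|g l - g 0| < d].
Proof.
move=> cf cg d0 pos.
have /cvgrPdist_lt/(_ _ d0)/nbhs_ballP[e /= e0 ge] := cg 0.
pose w := Num.min (e / 2) (1 / 2).
have w01 : 0 < w < 1.
  by rewrite /w lt_min gt_min; apply/andP; split; [apply/andP; split|apply/orP; right]; lra.
have we : w < e by rewrite /w gt_min; apply/orP; left; lra.
have /andP[w0 w1] := w01.
exists (f w - f 0); first by rewrite subr_gt0 pos.
move=> x /andP[fx xf].
have [l] : exists2 l, l \in `[0, w] & f l = x.
  apply: IVT; [exact: ltW | exact: continuous_subspaceT|].
  by rewrite ge_min le_max (ltW fx) /=; apply/orP; right; lra.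
rewrite in_itv /= => /andP[l0 lw] fl; exists l; split=> //; first by rewrite l0; lra.
rewrite distrC; apply: ge; rewrite /ball /= sub0r normrN ger0_norm //.
exact: le_lt_trans lw we.
Qed.

Lemma continuous_affine f a b : continuous f -> continuous (fun l : R => f (a + b * l)).
Proof.
move=> cf l; apply: (@continuous_comp _ _ _ (fun l : R => a + b * l) f); last exact: cf.
by apply: cvgD; [exact: cvg_cst|apply: cvgM; [exact: cvg_cst|exact: cvg_id]].
Qed.

Lemma hits_above f g a b d : continuous f -> continuous g ->
  0 <= a <= 1 -> 0 <= b <= 1 -> 0 < d ->
  (forall l, 0 < l < 1 -> f a < f (a + (b - a) * l)) ->
  exists2 e, 0 < e & forall x, f a < x < f a + e ->
    exists r, [/\ 0 <= r <= 1, f r = x & `|g r - g a| < d].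
Proof.
move=> cf cg /andP[a0 a1] /andP[b0 b1] d0 pos.
have [|e e0 H] := one_sided_hits (@continuous_affine f a (b - a) cf)
  (@continuous_affine g a (b - a) cg) d0.
  by move=> l /pos; rewrite mulr0 addr0.
exists e => // x; rewrite mulr0 addr0 in H => /H[l [/andP[l0 l1] fl gl]].
exists (a + (b - a) * l); split=> //; apply/andP; split; nra.
Qed.

Lemma hits_below f g a b d : continuous f -> continuous g ->
  0 <= a <= 1 -> 0 <= b <= 1 -> 0 < d ->
  (forall l, 0 < l < 1 -> f (a + (b - a) * l) < f a) ->
  exists2 e, 0 < e & forall x, f a - e < x < f a ->
    exists r, [/\ 0 <= r <= 1, f r = x & `|g r - g a| < d].
Proof.
move=> cf cg a01 b01 d0 neg.
have cf' : continuous (fun t : R => - f t) by move=> t; apply: cvgN; exact: cf.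
have [|e e0 H] := hits_above cf' cg a01 b01 d0.
  by move=> l /neg; rewrite ltrN2.
exists e => // x /andP[xf fx]; have [|r [r01 /oppr_inj fr gr]] := H (- x).
  by apply/andP; split; lra.
by exists r.
Qed.

(** The points with parameters [s] and [t] lie on the same vertical line and cut the
    closed curve into two arcs, each on one side of that line.  If both arcs
    were on the same side, a nearby vertical line would meet the curve three
    times.  So there is one arc on either side, which joins the two points and
    therefore provides, on each nearby vertical line, a point of the curve close
    to either of them. *)
Lemma two_arcs f g s t d : continuous f -> continuous g ->
  f 0 = f 1 -> g 0 = g 1 ->
  (forall a b c, 0 <= a -> a < b -> b < c -> c < 1 -> f a = f b -> f b = f c -> False) ->
  0 <= s -> s < t -> t < 1 -> f s = f t -> 0 < d ->
  exists2 e, 0 < e & forall x, `|x - f s| < e ->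
    (exists r, [/\ 0 <= r <= 1, f r = x & `|g r - g s| < d]) /\
    (exists r, [/\ 0 <= r <= 1, f r = x & `|g r - g t| < d]).
Proof.
move=> cf; pose m := (s + t) / 2.
wlog lt_m : f cf / f m < f s.
  move=> H cg f01 g01 two s0 st t1 fst d0.
  have [lt|gt|eq] := ltgtP (f m) (f s); first exact: H.
    have cf' : continuous (fun t : R => - f t) by move=> u; apply: cvgN; exact: cf.
    have two' a b c : 0 <= a -> a < b -> b < c -> c < 1 -> - f a = - f b -> - f b = - f c -> False.
      by move=> a0 ab bc c1 /oppr_inj ? /oppr_inj; apply: two a0 ab bc c1 _.
    have neg_m : - f m < - f s by rewrite ltrN2.
    have neg01 : - f 0 = - f 1 by rewrite f01.
    have neg_st : - f s = - f t by rewrite fst.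
    have [e e0 He] := H _ cf' neg_m cg neg01 g01 two' s0 st t1 neg_st d0.
    exists e => // x xe; have [|[r [r01 /oppr_inj fr gr]] [r' [r01' /oppr_inj fr' gr']]] := He (- x).
      by rewrite opprK addrC distrC.
    by split; [exists r | exists r'].
  by case: (two s m t) => //; rewrite /m; lra.
move=> cg f01 g01 two s0 st t1 fst d0.
have sm : s < m by rewrite /m; lra.
have mt : m < t by rewrite /m; lra.
have left_arc l : s < l < t -> f l < f s.
  move=> /andP[sl lt].
  have cf' : continuous (fun t : R => - f t) by move=> u; apply: cvgN; exact: cf.
  rewrite -ltrN2.
  apply: (@same_sign _ _ (Num.min l m) (Num.max l m) m l cf'); rewrite ?ltrN2 //.
  - move=> r /andP[lr rl]; rewrite eqr_opp; apply/eqP => fr.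
    have /andP[sr rt] : s < r < t.
      by apply/andP; split; [apply: lt_le_trans lr|apply: le_lt_trans rl _]; rewrite ?lt_min ?gt_max ?sl ?lt ?sm ?mt.
    by apply: (two s r t) => //; rewrite fr.
  - by rewrite ge_min le_max !lexx !orbT.
  - by rewrite ge_min le_max !lexx.
pose m' := (t + 1) / 2.
have tm' : t < m' by rewrite /m'; lra.
have m'1 : m' < 1 by rewrite /m'; lra.
have nz r : t < r < 1 -> f r != f s.
  by move=> /andP[tr r1]; apply/eqP => fr; apply: (two s t r) => //; rewrite -fst fr.
have gt_m' : f s < f m'.
  rewrite lt_neqAle eq_sym nz ?tm' //= leNgt; apply/negP => lt_m'.
  (* a level that each of [(s, m)], [(m, t)] and [(t, m')] attains *)
  pose x := (Num.max (f m) (f m') + f s) / 2.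
  have mx : Num.max (f m) (f m') < f s by rewrite gt_max lt_m.
  have xs : x < f s by rewrite /x; lra.
  have xm : f m < x.
    have : f m <= Num.max (f m) (f m') by rewrite le_max lexx.
    by rewrite /x; lra.
  have xm' : f m' < x.
    have : f m' <= Num.max (f m) (f m') by rewrite le_max lexx orbT.
    by rewrite /x; lra.
  have hit a b : a < b -> (f a < x < f b) || (f b < x < f a) ->
      exists2 r, a < r < b & f r = x.
    move=> ab vals; have [r] : exists2 r, r \in `[a, b] & f r = x.
      apply: IVT; [exact: ltW|exact: continuous_subspaceT|].
      by rewrite ge_min le_max; case/orP: vals => /andP[/ltW -> /ltW ->]; rewrite ?orbT.
    rewrite in_itv /= => /andP[ar rb] fr; exists r => //.
    rewrite !lt_neqAle ar rb !andbT; apply/andP; split; apply/eqP => e.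
      by move: vals; rewrite e fr ltxx andbF.
    by move: vals; rewrite -e fr ltxx andbF.
  have [|r1 /andP[? ?] f1] := hit s m sm; first by rewrite xm xs orbT.
  have [|r2 /andP[? ?] f2] := hit m t mt; first by rewrite xm -fst xs.
  have [|r3 /andP[? ?] f3] := hit t m' tm'; first by rewrite xm' -fst xs orbT.
  by apply: (two r1 r2 r3); rewrite ?f1 ?f2 ?f3 //; lra.
have right_arc l : t < l < 1 -> f s < f l.
  move=> /andP[tl l1].
  apply: (@same_sign _ _ (Num.min l m') (Num.max l m') m' l cf) => //.
  - move=> r /andP[lr rl]; apply: nz.
    by apply/andP; split; [apply: lt_le_trans lr|apply: le_lt_trans rl _]; rewrite ?lt_min ?gt_max ?tl ?l1 ?tm' ?m'1.
  - by rewrite ge_min le_max !lexx !orbT.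
  - by rewrite ge_min le_max !lexx.
have s01 : 0 <= s <= 1 by lra.
have t01 : 0 <= t <= 1 by lra.
have z01 : 0 <= (0 : R) <= 1 by rewrite ler01 lexx.
have o01 : 0 <= (1 : R) <= 1 by rewrite ler01 lexx.
have [|e1 e10 H1] := @hits_below f g s t d cf cg s01 t01 d0.
  move=> l /andP[l0 l1]; apply: left_arc; apply/andP; split; nra.
have [|e2 e20 H2] := @hits_below f g t s d cf cg t01 s01 d0.
  move=> l /andP[l0 l1]; rewrite -fst; apply: left_arc; apply/andP; split; nra.
have [|e3 e30 H3] := @hits_above f g t 1 d cf cg t01 o01 d0.
  move=> l /andP[l0 l1]; rewrite -fst; apply: right_arc; apply/andP; split; nra.
have [e4 e40 H4] : exists2 e, 0 < e & forall x, f s < x < f s + e ->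
    exists r, [/\ 0 <= r <= 1, f r = x & `|g r - g s| < d].
  (* for [s = 0] the second arc arrives at the parameter [1] *)
  have [s_eq0|s_neq0] := eqVneq s 0.
    rewrite s_eq0 f01 g01; apply: (@hits_above f g 1 t d cf cg o01 t01 d0).
    move=> l /andP[l0 l1]; rewrite -f01 -s_eq0; apply: right_arc.
    by apply/andP; split; nra.
  have sgt0 : 0 < s by rewrite lt_neqAle eq_sym s_neq0.
  have pos1 : f s < f 1.
    apply: (@same_sign _ _ m' 1 m' 1 cf) => //; rewrite ?lexx ?(ltW m'1) // => r /andP[mr r1].
    have [->|r_neq1] := eqVneq r 1.
      rewrite -f01; apply/eqP => e.
      by apply: (two 0 s t) => //; rewrite ?lexx.
    by apply: nz; rewrite (lt_le_trans tm' mr) lt_neqAle r_neq1.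
  apply: (@hits_above f g s 0 d cf cg s01 z01 d0).
  move=> l /andP[l0 l1]; rewrite sub0r; set r := s + _.
  have /andP[r0 rs] : 0 <= r < s by rewrite /r; apply/andP; split; nra.
  apply: (@same_sign _ _ 0 r 0 r cf); rewrite ?lexx ?r0 ?f01 // => r' /andP[r'0 r'r].
  apply/eqP => e; apply: (two r' s t) => //.
  exact: le_lt_trans rs.
pose e := Num.min (Num.min e1 e2) (Num.min e3 e4).
have [ee1 ee2 ee3 ee4] : [/\ e <= e1, e <= e2, e <= e3 & e <= e4].
  by split; rewrite /e !ge_min lexx ?orbT.
exists e; first by rewrite !lt_min e10 e20 e30 e40.
move=> x; rewrite ltr_norml => /andP[xl xr].
have [lt|gt|eq] := ltgtP x (f s).
- by split; [apply: H1|apply: H2]; rewrite -?fst; lra.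
- by split; [apply: H4|apply: H3]; rewrite -?fst; lra.
- by split; [exists s|exists t]; rewrite subrr normr0 ?eq; split.
Qed.
End Curves.

(** * The region of a curve *)

Section Regions.
Local Open Scope classical_set_scope.
Local Open Scope ring_scope.
Variable R : realType.
Implicit Types (K : set (R * R)) (p q v : R * R).

Lemma boundedW (A : set (R * R)) : bounded_set A -> exists M : R, forall p, A p -> `|p| <= M.
Proof.
move=> [M [_ HM]]; exists (M + 1) => p Ap.
by apply: (HM (M + 1)) => //; rewrite ltrDl.
Qed.

Lemma half_line_connected p v : connected (half_line p v).
Proof.
apply: connected_continuous_connected.
  by apply/connected_intervalP; exact: interval_is_interval.
apply: continuous_subspaceT => t.
by apply: cvgD; [exact: cvg_cst|apply: cvgZr_tmp; exact: cvg_id].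
Qed.

(** The half-line makes the component of [p] unbounded. *)
Lemma half_line_escapes K p v : v != 0 -> (forall q, half_line p v q -> ~ K q) ->
  ~ region K p.
Proof.
move=> v0 avoid; have pp : half_line p v p.
  by exists 0; rewrite /= ?in_itv /= ?lexx ?scale0r ?addr0.
case=> [Kp | [_ /boundedW[M HM]]]; first exact: (avoid p).
have sub : half_line p v `<=` connected_component (~` K) p.
  by apply: connected_component_max => //; exact: half_line_connected.
have nv : 0 < `|v| by rewrite normr_gt0.
have M0 : 0 <= M by apply: le_trans (HM p (sub p pp)).
pose t := (M + `|p| + 1) / `|v|.
have t0 : 0 <= t by rewrite /t divr_ge0 // !addr_ge0.
have /sub/HM : half_line p v (p + t *: v) by exists t; rewrite //= in_itv /= t0.
have : `|t *: v| = M + `|p| + 1 by rewrite normrZ ger0_norm // /t divfK // gt_eqF.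
have := ler_normB (p + t *: v) p; rewrite addrAC subrr add0r => le eqn leM.
by move: le; rewrite eqn; lra.
Qed.

(** Composing with a retraction of the line onto [[0, 1]] makes the coordinates
    continuous everywhere. *)
Lemma jordan_param K : jordan_curve K -> exists f g : R -> R,
  [/\ continuous f, continuous g, f 0 = f 1, g 0 = g 1 &
  (forall s t, 0 <= s < 1 -> 0 <= t < 1 -> f s = f t -> g s = g t -> s = t) /\
  (forall p, K p <-> exists2 t, 0 <= t <= 1 & p = (f t, g t))].
Proof.
case=> gamma [cont closed inj KE].
pose clamp (t : R) := Num.max 0 (Num.min 1 t).
have clamp01 t : 0 <= clamp t <= 1.
  by rewrite /clamp le_max lexx ge_max ler01 ge_min lexx.
have clamp_id t : 0 <= t <= 1 -> clamp t = t.
  by move=> /andP[t0 t1]; rewrite /clamp (min_idPr t1) (max_idPr t0).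
have ccont : continuous clamp.
  move=> t; apply: (@continuous_max R R (fun=> 0) (fun t => Num.min 1 t) t).
    exact: cvg_cst.
  by apply: (@continuous_min R R (fun=> 1) id t); [exact: cvg_cst|exact: cvg_id].
pose G := gamma \o clamp.
have cG : continuous G.
  move=> t; have /subspace_continuousP/(_ (clamp t)) := cont.
  rewrite /= in_itv /= => /(_ (clamp01 t)) H.
  move=> A /H HA; apply: (@filterS _ (nbhs t) _ _ _ _ (ccont t _ HA)) => u /=.
  by apply; rewrite in_itv /=.
have cfst : continuous (fun t => (G t).1).
  move=> t; apply: (@continuous_comp _ _ _ G fst); first exact: cG.
  exact: cvg_fst.
have csnd : continuous (fun t => (G t).2).
  move=> t; apply: (@continuous_comp _ _ _ G snd); first exact: cG.
  exact: cvg_snd.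
have z01 : 0 <= (0 : R) <= 1 by rewrite lexx ler01.
have o01 : 0 <= (1 : R) <= 1 by rewrite lexx ler01.
have ends : G 0 = G 1 by rewrite /G /= !clamp_id.
exists (fun t => (G t).1), (fun t => (G t).2); split; rewrite ?ends //; split.
  move=> s t /andP[s0 s1] /andP[t0 t1] e1 e2.
  have eG : G s = G t by rewrite [LHS]surjective_pairing [RHS]surjective_pairing e1 e2.
  have s01 : 0 <= s <= 1 by rewrite s0 ltW.
  have t01 : 0 <= t <= 1 by rewrite t0 ltW.
  rewrite /G /= !clamp_id // in eG.
  by apply: inj eG; rewrite inE /= in_itv /= ?s0 ?t0.
move=> p; rewrite KE; split=> [[t] | [t t01 ->]].
  rewrite /= in_itv /= => t01 <-; exists t => //.
  by rewrite /G /= clamp_id // -surjective_pairing.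
by exists t; rewrite /= ?in_itv //= /G /= clamp_id // -surjective_pairing.
Qed.

Lemma open_box (S : set (R * R)) :
  (forall p, S p -> exists2 e : R, 0 < e &
     forall q, `|q.1 - p.1| < e -> `|q.2 - p.2| < e -> S q) -> open S.
Proof.
move=> H; rewrite openE => p /H[e e0 He]; apply/nbhs_ballP; exists e => //= q [q1 q2].
by apply: He; rewrite distrC.
Qed.

Lemma jordan_bounded K : jordan_curve K -> exists M : R, forall p, K p -> `|p.1| <= M /\ `|p.2| <= M.
Proof.
case=> gamma [cont _ _ KE].
have : compact K by rewrite KE; apply: continuous_compact => //; exact: segment_compact.
move=> /compact_bounded/boundedW[M HM]; exists M => p /HM.
by rewrite prod_normE ge_max => /andP.
Qed.

(** Off this set [`|f t - p.1| + max 0 (p.2 - g t)] is positive for all [t]; its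
    minimum over [t] is attained and changes by at most twice the displacement
    of [p]. *)
Lemma closed_under_curve (f g : R -> R) : continuous f -> continuous g ->
  closed [set p : R * R | exists2 t, 0 <= t <= 1 & f t = p.1 /\ p.2 <= g t].
Proof.
move=> cf cg; rewrite -openC.
apply: open_box => p Hp.
pose F t := `|f t - p.1| + Num.max 0 (p.2 - g t).
have cF : continuous F.
  move=> t; apply: cvgD.
    by apply: cvg_norm; apply: cvgB; [exact: cf|exact: cvg_cst].
  apply: (@continuous_max R R (fun=> 0) (fun t => p.2 - g t) t); first exact: cvg_cst.
  by apply: cvgB; [exact: cvg_cst|exact: cg].
have [c] := EVT_min (@ler01 R) (continuous_subspaceT cF).
rewrite in_itv /= => c01 cmin.
have Fc0 : 0 < F c.
  rewrite lt_neqAle eq_sym; apply/andP; split; last by rewrite addr_ge0 ?le_max ?lexx.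
  apply/eqP => Fc; apply: Hp; exists c => //.
  have n0 := normr_ge0 (f c - p.1).
  have m0 : 0 <= Num.max 0 (p.2 - g c) by rewrite le_max lexx.
  have m1 : p.2 - g c <= Num.max 0 (p.2 - g c) by rewrite le_max lexx orbT.
  rewrite /F in Fc; split=> /=; last by lra.
  have : `|f c - p.1| = 0 by lra.
  by move/normr0P; rewrite subr_eq0 => /eqP.
exists (F c / 2); first by rewrite divr_gt0.
move=> q q1 q2 [t t01] [fq qg].
have := cmin t; rewrite in_itv /= => /(_ t01).
rewrite {2}/F fq => le.
have : Num.max 0 (p.2 - g t) < F c / 2.
  rewrite gt_max; apply/andP; split; first by rewrite divr_gt0.
  by move: q2; rewrite ltr_norml => /andP[]; lra.
by lra.
Qed.

Lemma closed_over_curve (f g : R -> R) : continuous f -> continuous g ->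
  closed [set p : R * R | exists2 t, 0 <= t <= 1 & f t = p.1 /\ g t <= p.2].
Proof.
move=> cf cg; have cg' : continuous (fun t => - g t) by move=> t; apply: cvgN; exact: cg.
pose flip (p : R * R) := (p.1, - p.2).
have -> : [set p : R * R | exists2 t, 0 <= t <= 1 & f t = p.1 /\ g t <= p.2] =
    flip @^-1` [set p : R * R | exists2 t, 0 <= t <= 1 & f t = p.1 /\ p.2 <= - g t].
  by apply/seteqP; split=> p [t t01 [fp gp]]; exists t => //; split=> //; rewrite ?lerN2 // -lerN2.
apply: preimage_closed; last exact: closed_under_curve.
move=> p _; apply: (@cvg_pair _ _ _ (nbhs p) (nbhs p.1) (nbhs (- p.2)) _ _ _ fst (fun z : R * R => - z.2)); first exact: cvg_fst.
by apply: cvgN; exact: cvg_snd.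
Qed.

Lemma x_monotone_two K p q r : x_monotone K -> K p -> K q -> K r ->
  p.1 = q.1 -> q.1 = r.1 -> [\/ p = q, q = r | p = r].
Proof.
move=> mono Kp Kq Kr pq qr.
have [h] := pcard_leP (mono q.1).
have hI z : K z -> z.1 = q.1 -> (h z < 2)%N by move=> Kz zq; apply: (@funS _ _ _ _ h); split.
have hinj z z' : K z -> K z' -> z.1 = q.1 -> z'.1 = q.1 -> h z = h z' -> z = z'.
  by move=> Kz Kz' zq zq'; apply: (@inj _ _ _ h); rewrite inE; split.
have := hI p Kp pq; have := hI q Kq erefl; have := hI r Kr (esym qr).
have := hinj p q Kp Kq pq erefl; have := hinj q r Kq Kr erefl (esym qr).
have := hinj p r Kp Kr pq (esym qr).
case: (h p) => [|[|//]]; case: (h q) => [|[|//]]; case: (h r) => [|[|//]] //;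
  by move=> pr qr' pq' _ _ _; first [exact: Or31 (pq' erefl) | exact: Or32 (qr' erefl)
    | exact: Or33 (pr erefl)].
Qed.

Lemma between_open K : jordan_curve K -> x_monotone K ->
  open [set p | (exists2 k, K k & k.1 = p.1 /\ k.2 < p.2) /\
                (exists2 k, K k & k.1 = p.1 /\ p.2 < k.2)].
Proof.
move=> /jordan_param[f [g [cf cg f01 g01 [inj KE]]]] mono.
have two a b c : 0 <= a -> a < b -> b < c -> c < 1 -> f a = f b -> f b = f c -> False.
  move=> a0 ab bc c1 fab fbc.
  have KI t : 0 <= t < 1 -> K (f t, g t).
    by move=> /andP[t0 t1]; apply/KE; exists t; rewrite // t0 ltW.
  have a01 : 0 <= a < 1 by lra.
  have b01 : 0 <= b < 1 by lra.
  have c01 : 0 <= c < 1 by lra.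
  have [||[] _ /inj|[] _ /inj|[] _ /inj] :=
    x_monotone_two mono (KI a a01) (KI b b01) (KI c c01) => //.
  - by move=> /(_ a01 b01 fab); lra.
  - by move=> /(_ b01 c01 fbc); lra.
  - by move=> /(_ a01 c01 (etrans fab fbc)); lra.
have start k : K k -> exists2 t, 0 <= t < 1 & k = (f t, g t).
  case/KE=> t /andP[t0]; rewrite le_eqVlt => /predU1P[-> ->|t1 ->]; last by exists t; rewrite ?t0.
  by exists 0; rewrite ?lexx ?ltr01 ?f01 ?g01.
apply: open_box => p [[_ /start[s s01 ->] /= [fs gs]] [_ /start[t t01 ->] /= [ft gt]]].
pose d := Num.min (p.2 - g s) (g t - p.2) / 2.
have [d0 ds dt] : [/\ 0 < d, 2 * d <= p.2 - g s & 2 * d <= g t - p.2].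
  by rewrite /d; case: (leP (p.2 - g s) (g t - p.2)) => ?; split; lra.
have [e e0 He] : exists2 e, 0 < e & forall x, `|x - p.1| < e ->
    (exists r, [/\ 0 <= r <= 1, f r = x & `|g r - g s| < d]) /\
    (exists r, [/\ 0 <= r <= 1, f r = x & `|g r - g t| < d]).
  have [st|ts|st] := ltgtP s t; last by move: gs gt; rewrite st; lra.
    rewrite -fs; apply: two_arcs => //; [lra|lra|by rewrite fs ft].
  have [|||||e e0 He] := @two_arcs _ f g t s d cf cg f01 g01 two; rewrite ?fs ?ft //; try lra.
  by exists e => // x; rewrite -ft => /He[].
exists (Num.min e d); first by rewrite lt_min e0.
move=> q; rewrite !lt_min => /andP[/He[[r [r01 fr gr]] [r' [r01' fr' gr']]] _] /andP[_ q2].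
move: q2 gr gr'; rewrite !ltr_norml => /andP[? ?] /andP[? ?] /andP[? ?].
have Kr : K (f r, g r) by apply/KE; exists r.
have Kr' : K (f r', g r') by apply/KE; exists r'.
by split; [exists (f r, g r) | exists (f r', g r')] => //; split=> //=; lra.
Qed.

Lemma move_alongE p v (t : R) : p + t *: v = (p.1 + t * v.1, p.2 + t * v.2).
Proof. by []. Qed.

Lemma escapes_up K x y : (forall y', y <= y' -> ~ K (x, y')) -> ~ region K (x, y).
Proof.
move=> avoid; apply: (@half_line_escapes _ _ (0, 1)).
  by apply/eqP => -[] e; have := oner_neq0 R; rewrite e eqxx.
move=> q [t] /=; rewrite in_itv /= andbT => t0 <-.
rewrite move_alongE /= mulr0 addr0 mulr1.
by apply: avoid; rewrite lerDl.
Qed.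

Lemma escapes_down K x y : (forall y', y' <= y -> ~ K (x, y')) -> ~ region K (x, y).
Proof.
move=> avoid; apply: (@half_line_escapes _ _ (0, -1)).
  by apply/eqP => -[] e; have := oner_neq0 R; rewrite -oppr_eq0 e eqxx.
move=> q [t] /=; rewrite in_itv /= andbT => t0 <-.
rewrite move_alongE /= mulr0 addr0 mulrN1.
by apply: avoid; rewrite gerDl oppr_le0.
Qed.

(** A point [(x, y)] outside the region but between two of its points has a curve
    point below it and one above, as otherwise one of the two points could
    escape vertically.  The set of points so enclosed is open, and its
    intersection with the complement of the curve is also that of a closed set;
    hence it contains the component of [(x, y)], which is then bounded. *)
Lemma x_monotone_vconvex K : jordan_curve K -> x_monotone K -> vconvex (region K).
Proof.
move=> jK mono x y1 y y2 /andP[y1y yy2] R1 R2; apply: contrapT => nR.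
have nK : ~ K (x, y) by move=> Kxy; apply: nR; left.
have below : exists2 k, K k & k.1 = x /\ k.2 < y.
  apply: contrapT => none; apply: escapes_down R1 => y' y'y Ky'; apply: none.
  exists (x, y') => //; split=> //=; rewrite lt_neqAle (le_trans y'y) // andbT.
  by apply/eqP => e; rewrite e in Ky'.
have above : exists2 k, K k & k.1 = x /\ y < k.2.
  apply: contrapT => none; apply: escapes_up R2 => y' y'y Ky'; apply: none.
  exists (x, y') => //; split=> //=; rewrite lt_neqAle (le_trans yy2) // andbT.
  by apply/eqP => e; rewrite -e in Ky'.
have [f [g [cf cg _ _ [_ KE]]]] := jordan_param jK.
pose S := [set p : R * R | (exists2 k, K k & k.1 = p.1 /\ k.2 < p.2) /\
                           (exists2 k, K k & k.1 = p.1 /\ p.2 < k.2)].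
pose S' := [set p : R * R | exists2 t, 0 <= t <= 1 & f t = p.1 /\ g t <= p.2] `&`
           [set p : R * R | exists2 t, 0 <= t <= 1 & f t = p.1 /\ p.2 <= g t].
have SS' p : S p -> S' p.
  case=> -[_ /KE[t t01 ->] /= [ft gt]] [_ /KE[t' t01' ->] /= [ft' gt']].
  by split; [exists t|exists t'] => //; split=> //; apply: ltW.
have S'S p : ~ K p -> S' p -> S p.
  move=> nKp [[t t01 [ft gt]] [t' t01' [ft' gt']]].
  have Kt : K (f t, g t) by apply/KE; exists t.
  have Kt' : K (f t', g t') by apply/KE; exists t'.
  split; [exists (f t, g t)|exists (f t', g t')] => //; split=> //=.
    rewrite lt_neqAle gt andbT; apply/eqP => e; apply: nKp.
    by rewrite [p]surjective_pairing -ft -e.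
  rewrite lt_neqAle gt' andbT; apply/eqP => e; apply: nKp.
  by rewrite [p]surjective_pairing -ft' e.
apply: nR; right; split=> //.
set C := connected_component (~` K) (x, y).
have CK p : C p -> ~ K p by exact: connected_component_sub.
have CS : C `&` S = C.
  apply: (@component_connected _ (~` K) (x, y)).
  - exists (x, y); split; last by split.
    exact: connected_component_refl.
  - by exists S => //; apply: between_open.
  exists S'; first by apply: closedI; [exact: closed_over_curve|exact: closed_under_curve].
  apply/seteqP; split=> p [Cp Sp]; split=> //; first exact: SS'.
  by apply: S'S => //; apply: CK.
have [M HM] := jordan_bounded jK.
exists M; split; first exact: num_real.
move=> M' MM' p /=; rewrite -/C -CS => -[_ [[k Kk [k1 k2]] [k' Kk' [k1' k2']]]].
have [a b] := HM _ Kk; have [a' b'] := HM _ Kk'.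
rewrite prod_normE ge_max -k1 (le_trans a (ltW MM')) /= ler_norml.
move: b b'; rewrite !ler_norml => /andP[? ?] /andP[? ?].
by apply/andP; split; lra.
Qed.

(** A point of the curve above [p] and one below would make three on a line. *)
Lemma x_monotone_upper_lower K p : x_monotone K -> K p ->
  upper (region K) p \/ lower (region K) p.
Proof.
move=> mono Kp; have [[k Kk [k1 k2]]|none] := pselect (exists2 k, K k & k.1 = p.1 /\ p.2 < k.2).
  right=> y yp; apply: escapes_down => y' y'y Ky'.
  have ltp : y' < p.2 := le_lt_trans y'y yp.
  have [e|e|e] := x_monotone_two mono Ky' Kp Kk erefl (esym k1).
  - by move: ltp; rewrite -e ltxx.
  - by move: k2; rewrite e ltxx.
  - by move: (lt_trans ltp k2); rewrite -e ltxx.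
left=> y py; apply: escapes_up => y' yy' Ky'; apply: none.
by exists (p.1, y') => //; split=> //=; apply: lt_le_trans yy'.
Qed.

End Regions.

(** * The region of a star-shaped curve *)

Section StarRegion.
Local Open Scope classical_set_scope.
Local Open Scope ring_scope.
Variable R : realType.
Variables (K : set (R * R)) (c : R * R).
Hypotheses (jK : jordan_curve K) (Rc : region K c).
Hypothesis ray : forall v : R * R, v != 0 -> exists p, K `&` half_line c v = [set p].

Let ray_inj (v p q : R * R) : v != 0 -> K p -> half_line c v p -> K q -> half_line c v q -> p = q.
Proof.
move=> v0 Kp hp Kq hq; have [r rE] := ray v0.
have -> : p = r by change ([set r] p); rewrite -rE; split.
by apply/esym; change ([set r] q); rewrite -rE; split.
Qed.

(** Otherwise each ray would meet the curve in the centre only, and the curve would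
    be reduced to it. *)
Lemma center_notin : ~ K c.
Proof.
move=> Kc.
have hc v : half_line c v c by exists 0; rewrite /= ?in_itv /= ?lexx ?scale0r ?addr0.
have onlyc k : K k -> k = c.
  move=> Kk; have [->//|kc] := eqVneq k c.
  apply: (@ray_inj (k - c)) => //; first by rewrite subr_eq0.
  by exists 1; rewrite /= ?in_itv /= ?ler01 // scale1r addrC subrK.
have [f [g [_ _ _ _ [inj KE]]]] := jordan_param jK.
have z01 : 0 <= (0 : R) < 1 by rewrite lexx ltr01.
have h01 : 0 <= (1 / 2 : R) < 1 by lra.
have K0 : K (f 0, g 0) by apply/KE; exists 0; rewrite ?lexx ?ler01.
have Kh : K (f (1 / 2), g (1 / 2)) by apply/KE; exists (1 / 2) => //; lra.
have := onlyc _ K0; rewrite -(onlyc _ Kh) => -[e1 e2].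
by have := inj _ _ z01 h01 e1 e2; lra.
Qed.

Lemma beyond_escapes k t : K k -> 1 < t -> ~ region K (c + t *: (k - c)).
Proof.
move=> Kk t1; have kc : k - c != 0.
  by rewrite subr_eq0; apply/eqP => e; apply: center_notin; rewrite -e.
apply: (half_line_escapes kc) => q [u] /=; rewrite in_itv /= andbT => u0 <- Kq.
have : c + t *: (k - c) + u *: (k - c) = k.
  apply: (ray_inj kc) => //.
    by exists (t + u); rewrite /= ?in_itv /= ?scalerDl ?addrA //; lra.
  by exists 1; rewrite /= ?in_itv /= ?ler01 // scale1r addrC subrK.
move/(congr1 (fun z => z - c)); rewrite -(addrA c) -scalerDl addrAC subrr add0r => e.
have : (t + u - 1) *: (k - c) = 0 by rewrite scalerBl scale1r e subrr.
by move/eqP; rewrite scaler_eq0 (negPf kc) orbF => /eqP; lra.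
Qed.

(** On the ray of [z] the region does not extend beyond the curve point; before it
    the ray is connected to the centre in the complement of the curve. *)
Lemma region_toward_center z t : 0 <= t <= 1 -> region K (c + z) -> region K (c + t *: z).
Proof.
move=> /andP[t0 t1] Rz; have [->|z0] := eqVneq z 0; first by rewrite scaler0 addr0.
have [p pE] := ray z0; have [Kp [r r0 rp]] : (K `&` half_line c z) p by rewrite pE.
rewrite /= in_itv /= andbT in r0.
have r_gt0 : 0 < r.
  rewrite lt_neqAle r0 andbT eq_sym; apply/eqP => e; apply: center_notin.
  by move: Kp; rewrite -rp e scale0r addr0.
have r1 : 1 <= r.
  rewrite leNgt; apply/negP => lt; apply: (@beyond_escapes p r^-1 Kp); first by rewrite invf_gt1.
  by rewrite -rp [c + r *: z]addrC addrK scalerA mulVf ?gt_eqF // scale1r.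
have [->|tr] := eqVneq t r; first by left; rewrite rp.
have {}tr : t < r by rewrite lt_neqAle tr (le_trans t1).
pose B := [set c + u *: z | u in `[0, t]].
have Bc : B c by exists 0; rewrite /= ?in_itv /= ?lexx // scale0r addr0.
have Bt : B (c + t *: z) by exists t; rewrite //= in_itv /= t0 lexx.
have BK : B `<=` ~` K.
  move=> w [u] /=; rewrite in_itv /= => /andP[u0 ut] <- Ku.
  have : c + u *: z = c + r *: z.
    apply: (ray_inj z0) => //; [by exists u; rewrite //= in_itv /= u0|by rewrite rp|].
    by exists r; rewrite //= in_itv /= r0.
  move/(congr1 (fun w => w - c)); rewrite addrAC subrr add0r addrAC subrr add0r => e.
  have : (r - u) *: z = 0 by rewrite scalerBl e subrr.
  by move/eqP; rewrite scaler_eq0 (negPf z0) orbF => /eqP; lra.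
have cB : connected B.
  apply: connected_continuous_connected.
    by apply/connected_intervalP; exact: interval_is_interval.
  apply: continuous_subspaceT => u.
  by apply: cvgD; [exact: cvg_cst|apply: cvgZr_tmp; exact: cvg_id].
have comp : connected_component (~` K) c (c + t *: z).
  by move: Bt; apply: connected_component_max.
right; split; first exact: BK.
rewrite -(same_connected_component comp).
by case: Rc => [Kc|[] //]; case: (center_notin Kc).
Qed.

Let Reg (z : R * R) := region K (c.1 + z.1, c.2 + z.2).

Lemma star_region_star_like : star_like Reg.
Proof. by move=> z t t01; apply: region_toward_center. Qed.

Lemma star_region_tip k : K k -> tip Reg (k.1 - c.1, k.2 - c.2).
Proof. by move=> Kk t t1; apply: beyond_escapes. Qed.

Lemma horizontal_points : exists p q : R * R, forall k, K k -> k.2 = c.2 -> k = p \/ k = q.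
Proof.
have e1 : (1, 0) != 0 :> R * R by apply/eqP => -[] e; have := oner_neq0 R; rewrite e eqxx.
have e2 : (-1, 0) != 0 :> R * R.
  by apply/eqP => -[] e; have := oner_neq0 R; rewrite -oppr_eq0 e eqxx.
have [p pE] := ray e1; have [q qE] := ray e2; exists p, q => k Kk k2.
have [le|lt] := leP c.1 k.1.
  left; change ([set p] k); rewrite -pE; split=> //; exists (k.1 - c.1).
    by rewrite /= in_itv /= subr_ge0 le.
  by rewrite move_alongE /= [k in RHS]surjective_pairing k2; congr (_, _); ring.
right; change ([set q] k); rewrite -qE; split=> //; exists (c.1 - k.1).
  by rewrite /= in_itv /= subr_ge0 ltW.
by rewrite move_alongE /= [k in RHS]surjective_pairing k2; congr (_, _); ring.
Qed.
End StarRegion.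

(** * Visibility graphs *)

Lemma edges_cover (V : finType) (G : V -> V -> bool) (Es : seq (V -> V -> bool)) :
  (forall x y, G x y -> has (fun E => E x y || E y x) Es) ->
  (#|edges G| <= \sum_(E <- Es) #|[set e | E e.1 e.2]|)%N.
Proof.
move=> GE; pose f (e : V * V) : {set V} := [set e.1; e.2].
pose D := [set e : V * V | has (fun E : V -> V -> bool => E e.1 e.2) Es].
apply: (@leq_trans #|D|).
  apply: leq_trans (leq_imset_card f D).
  apply/subset_leq_card/fintype.subsetP=> e; rewrite inE.
  case/existsP=> x /existsP[y /andP[/GE/hasP[E EsE /orP[Exy|Eyx]] /eqP ->]]; apply/imsetP.
    by exists (x, y) => //; rewrite inE; apply/hasP; exists E.
  by exists (y, x); rewrite /f 1?finset.setUC // inE; apply/hasP; exists E.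
rewrite /D; elim: Es {GE D} => [|E Es IH].
  by rewrite big_nil leqn0 cards_eq0; apply/eqP/setP=> e; rewrite !inE.
rewrite big_cons; apply: leq_trans (leq_add (leqnn _) IH).
apply: leq_trans (leq_card_setU _ _).
by apply/subset_leq_card/fintype.subsetP=> e; rewrite !inE.
Qed.

Lemma biclique_free_sub (V : finType) (G : rel V) (E : V -> V -> bool) s :
  (0 < s)%N -> irreflexive G -> ~ contains_Kss G s -> (forall x y, E x y -> G x y) ->
  biclique_free E s.
Proof.
move=> s0 irr free EG A B sA sB AB; apply: free.
have shrink (X : {set V}) : (s <= #|X|)%N -> exists2 Y : {set V}, Y \subset X & #|Y| = s.
  have rank_inj : injective (fun v : V => enum_rank v : nat).
    by move=> v w /ord_inj/enum_rank_inj.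
  move=> sX; have sX' : (0 < s <= #|X|)%N by rewrite s0.
  have [b _ bs] := first_block rank_inj sX'.
  exists [set y in X | (enum_rank y <= enum_rank b)%N] => //.
  by apply/fintype.subsetP=> y; rewrite inE => /andP[].
have [A' A'A cA'] := shrink A sA; have [B' B'B cB'] := shrink B sB.
have AB' x y : x \in A' -> y \in B' -> G x y.
  by move=> xA yB; apply/EG/AB; [apply: (fintype.subsetP A'A)|apply: (fintype.subsetP B'B)].
exists A', B'; split=> //; rewrite disjoint_subset; apply/fintype.subsetP=> x xA.
by rewrite inE; apply/negP => xB; have := AB' x x xA xB; rewrite irr.
Qed.

Section Visibility.
Variable R : realType.
Implicit Types (K : set (R * R)) (P : {fset R * R}) (p q z : R * R).

Lemma segment_sees K p q : (segment p q `<=` region K)%classic <-> sees (region K) p q.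
Proof.
split=> [sub t t01|see _ [t t01 <-]]; last exact: see.
by apply: sub; exists t; rewrite //= in_itv.
Qed.

Lemma visibility_sees K P (x y : P) :
  visibility_graph K P x y <-> x != y /\ sees (region K) (val x) (val y).
Proof. by split=> [/andP[xy /asboolP/segment_sees]|[xy /segment_sees/asboolP see]] //; apply/andP. Qed.

Definition flip_x p := (- p.1, p.2).
Definition flip_y p := (p.1, - p.2).

Lemma flip_yK p : flip_y (flip_y p) = p. Proof. by case: p => a b; rewrite /flip_y /= opprK. Qed.

Lemma sees_flip_x (Reg : R * R -> Prop) p q :
  sees (Reg \o flip_x) (flip_x p) (flip_x q) <-> sees Reg p q.
Proof.
by split=> H t /H; congr Reg; rewrite /flip_x /=; congr (_, _); ring.
Qed.

Lemma sees_flip_y (Reg : R * R -> Prop) p q :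
  sees (Reg \o flip_y) (flip_y p) (flip_y q) <-> sees Reg p q.
Proof.
by split=> H t /H; congr Reg; rewrite /flip_y /=; congr (_, _); ring.
Qed.

(** The classes: two tops, a top left of a bottom, two bottoms (turned upside
    down), a top right of a bottom (mirrored), and two points on one vertical
    line. *)
Lemma x_monotone_edges (s : nat) K P :
  (0 < s)%N -> jordan_curve K -> x_monotone K -> (forall p, p \in P -> K p) ->
  ~ contains_Kss (visibility_graph K P) s ->
  (#|edges (visibility_graph K P)| <= s * (69 * #|{: P}|))%N.
Proof.
move=> s0 jK mono PK free; set G := visibility_graph K P in free *.
have irr : irreflexive G by move=> x; rewrite /G /visibility_graph eqxx.
have vc := x_monotone_vconvex jK mono.
have Kval (x : P) : K (val x) by apply/PK/valP.
pose Reg : R * R -> Prop := region K.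
pose UU (x y : P) := `[< [/\ upper Reg (val x), upper Reg (val y),
  (val x).1 < (val y).1 & sees Reg (val x) (val y)] >].
pose UL (x y : P) := `[< [/\ upper Reg (val x), lower Reg (val y),
  (val x).1 < (val y).1 & sees Reg (val x) (val y)] >].
pose LL (x y : P) := `[< [/\ upper (Reg \o flip_y) (flip_y (val x)), upper (Reg \o flip_y) (flip_y (val y)),
  (flip_y (val x)).1 < (flip_y (val y)).1 & sees (Reg \o flip_y) (flip_y (val x)) (flip_y (val y))] >].
pose LU (x y : P) := `[< [/\ upper (Reg \o flip_x) (flip_x (val x)), lower (Reg \o flip_x) (flip_x (val y)),
  (flip_x (val x)).1 < (flip_x (val y)).1 & sees (Reg \o flip_x) (flip_x (val x)) (flip_x (val y))] >].
pose Vert (x y : P) := ((val x).1 == (val y).1) && (x != y).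
have bf (E : P -> P -> bool) : (forall x y : P, E x y -> (val x).1 != (val y).1 /\ sees Reg (val x) (val y)) ->
    biclique_free E s.
  move=> EG; apply: (biclique_free_sub s0 irr free) => x y /EG[xy see].
  by apply/visibility_sees; split=> //; apply: contraNneq xy => ->.
have bUU : (#|[set e | UU e.1 e.2]| <= s * (18 * #|{: P}|))%N.
  apply: (@upper_upper_bound _ _ val Reg) => //; first by move=> x y; split=> /asboolP.
  by apply: bf => x y /asboolP[_ _ lt see]; rewrite lt_eqF.
have bUL : (#|[set e | UL e.1 e.2]| <= s * (16 * #|{: P}|))%N.
  apply: (@upper_lower_bound _ _ val Reg) => //; first by move=> x y; split=> /asboolP.
  by apply: bf => x y /asboolP[_ _ lt see]; rewrite lt_eqF.
have bLL : (#|[set e | LL e.1 e.2]| <= s * (18 * #|{: P}|))%N.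
  apply: (@upper_upper_bound _ _ (flip_y \o val) (Reg \o flip_y)) => //.
  - by move=> x y /= e; apply/val_inj; rewrite -[LHS]flip_yK e flip_yK.
  - by move=> x y1 y y2 /andP[y1y yy2] R1 R2; apply: (vc x (- y2) (- y) (- y1)); rewrite ?lerN2 ?yy2.
  - by move=> x y; split=> /asboolP.
  by apply: bf => x y /asboolP[_ _ lt /sees_flip_y see]; rewrite lt_eqF.
have bLU : (#|[set e | LU e.1 e.2]| <= s * (16 * #|{: P}|))%N.
  apply: (@upper_lower_bound _ _ (flip_x \o val) (Reg \o flip_x)) => //.
  - by move=> x y1 y y2; apply: vc.
  - by move=> x y; split=> /asboolP.
  by apply: bf => x y /asboolP[_ _ + /sees_flip_x see]; rewrite /= ltrN2 => lt; rewrite gt_eqF.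
have bV : (#|[set e | Vert e.1 e.2]| <= 1 * #|{: P}|)%N.
  rewrite -cardsT; apply: (@card_pairs_le _ _ Vert) => // x _.
  apply/card_le1_eqP => y y'; rewrite !inE => /andP[/eqP xy nxy] /andP[/eqP xy' nxy'].
  have [e|e|e] := x_monotone_two mono (Kval y) (Kval x) (Kval y') (esym xy) xy'.
  - by rewrite (val_inj e) eqxx in nxy.
  - by rewrite (val_inj e) eqxx in nxy'.
  - exact: val_inj.
apply: (@leq_trans (\sum_(E <- [:: UU; UL; LL; LU; Vert]) #|[set e | E e.1 e.2]|)); last first.
  by rewrite !big_cons big_nil; nia.
apply: edges_cover.
have side (x : P) : upper Reg (val x) \/ lower Reg (val x) by apply: x_monotone_upper_lower.
have lower_flip (p : R * R) : lower Reg p -> upper (Reg \o flip_y) (flip_y p).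
  by move=> lo y /= lt; apply: lo; rewrite ltrNl.
have upper_flip (p : R * R) : upper Reg p -> upper (Reg \o flip_x) (flip_x p).
  by move=> up y lt; rewrite /flip_x /= opprK; apply: up.
have lower_flip_x (p : R * R) : lower Reg p -> lower (Reg \o flip_x) (flip_x p).
  by move=> lo y lt; rewrite /flip_x /= opprK; apply: lo.
have half x y : (val x).1 < (val y).1 -> sees Reg (val x) (val y) ->
    [|| UU x y, UL x y, LL x y | LU y x].
  move=> xy see; have [ux|lx] := side x; have [uy|ly] := side y.
  - by apply/orP; left; apply/asboolP.
  - by apply/or4P; apply: Or42; apply/asboolP.
  - apply/or4P; apply: Or44; apply/asboolP; split; [exact: upper_flip|exact: lower_flip_x|by rewrite /= ltrN2|].
    by apply/sees_flip_x; apply: sees_sym.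
  - by apply/or4P; apply: Or43; apply/asboolP; split=> //; [exact: lower_flip|exact: lower_flip|apply/sees_flip_y].
move=> x y /visibility_sees[xy see] /=.
have [lt|lt|eq] := ltgtP (val x).1 (val y).1.
- by case/or4P: (half x y lt see) => ->; rewrite ?orbT.
- by case/or4P: (half y x lt (sees_sym see)) => ->; rewrite ?orbT.
by rewrite /Vert eq eqxx xy !orbT.
Qed.

Definition half_turn p := (- p.1, - p.2).

Lemma sees_half_turn (Reg : R * R -> Prop) p q :
  sees (Reg \o half_turn) (half_turn p) (half_turn q) <-> sees Reg p q.
Proof.
by split=> H t /H; congr Reg; rewrite /half_turn /=; congr (_, _); ring.
Qed.

Lemma star_like_half_turn (Reg : R * R -> Prop) : star_like Reg -> star_like (Reg \o half_turn).
Proof. by move=> star z t t01 /= /(star _ _ t01); congr Reg; rewrite /half_turn /= !mulrN. Qed.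

Lemma tip_half_turn (Reg : R * R -> Prop) p : tip Reg p -> tip (Reg \o half_turn) (half_turn p).
Proof. by move=> tp t t1 H; apply: (tp t t1); move: H; congr Reg; rewrite /half_turn /= !mulrN !opprK. Qed.

Lemma wedge_half_turn p q : wedge (half_turn p) (half_turn q) = wedge p q.
Proof. by rewrite /wedge /= !mulrNN. Qed.

(** The classes: pairs in the upper half-plane, in the lower one (turned by a half
    turn), pairs in opposite half-planes for which the centre is on the left or
    on the right of the sight line, and pairs with a point level with the
    centre. *)
Lemma star_edges (s : nat) K P :
  (0 < s)%N -> jordan_curve K -> star_shaped K -> (forall p, p \in P -> K p) ->
  ~ contains_Kss (visibility_graph K P) s ->
  (#|edges (visibility_graph K P)| <= s * (70 * #|{: P}|))%N.
Proof.
move=> s0 jK [c Rc ray] PK free; set G := visibility_graph K P in free *.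
have irr : irreflexive G by move=> x; rewrite /G /visibility_graph eqxx.
pose Reg (z : R * R) := region K (c.1 + z.1, c.2 + z.2).
pose pos (x : P) := ((val x).1 - c.1, (val x).2 - c.2).
have star : star_like Reg := star_region_star_like jK Rc ray.
have tips x : tip Reg (pos x) by apply: (star_region_tip jK ray); apply/PK/valP.
have pos_inj : injective pos.
  move=> x y [/addIr e1 /addIr e2]; apply: val_inj.
  by rewrite [LHS]surjective_pairing [RHS]surjective_pairing e1 e2.
have sees_pos x y : sees Reg (pos x) (pos y) <-> sees (region K) (val x) (val y).
  by split=> H t /H; rewrite /Reg /pos /=; congr (region K); congr (_, _); ring.
pose half (Rg : R * R -> Prop) (f : P -> R * R) (x y : P) :=
  `[< [/\ 0 < (f x).2 /\ 0 < (f y).2, tip Rg (f x), tip Rg (f y),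
          0 < wedge (f x) (f y) & sees Rg (f x) (f y)] >].
pose opp (Rg : R * R -> Prop) (f : P -> R * R) (x y : P) :=
  `[< [/\ 0 < (f x).2 /\ (f y).2 < 0, tip Rg (f x), tip Rg (f y),
          0 <= wedge (f x) (f y) & sees Rg (f x) (f y)] >].
pose level (x y : P) := (pos x).2 == 0.
have bf (E : P -> P -> bool) : (forall x y : P, E x y -> x != y /\ sees Reg (pos x) (pos y)) ->
    biclique_free E s.
  move=> EG; apply: (biclique_free_sub s0 irr free) => x y /EG[xy see].
  by apply/visibility_sees; split=> //; apply/sees_pos.
have wedge_self p : wedge p p = 0 by rewrite /wedge mulrC subrr.
have b1 : (#|[set e | half Reg pos e.1 e.2]| <= s * (18 * #|{: P}|))%N.
  apply: (@half_plane_bound _ _ pos Reg) => //; first by move=> x y; split=> /asboolP.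
  apply: bf => x y /asboolP[_ _ _ lt see]; split=> //.
  by apply: contraTneq lt => ->; rewrite wedge_self ltxx.
have b2 : (#|[set e | half (Reg \o half_turn) (half_turn \o pos) e.1 e.2]| <= s * (18 * #|{: P}|))%N.
  apply: (@half_plane_bound _ _ (half_turn \o pos) (Reg \o half_turn)) => //.
  - exact: star_like_half_turn.
  - by move=> x y [/oppr_inj e1 /oppr_inj e2]; apply: pos_inj; congr (_, _).
  - by move=> x y; split=> /asboolP.
  apply: bf => x y /asboolP[_ _ _ lt /sees_half_turn see]; split=> //.
  by apply: contraTneq lt => ->; rewrite wedge_self ltxx.
have b3 : (#|[set e | opp Reg pos e.1 e.2]| <= s * (16 * #|{: P}|))%N.
  apply: (@opposite_bound _ _ pos Reg) => //; first by move=> x y; split=> /asboolP.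
  apply: bf => x y /asboolP[[x0 y0] _ _ _ see]; split=> //.
  by apply: contraTneq x0 => ->; rewrite -leNgt ltW.
have b4 : (#|[set e | opp (Reg \o half_turn) (half_turn \o pos) e.1 e.2]| <= s * (16 * #|{: P}|))%N.
  apply: (@opposite_bound _ _ (half_turn \o pos) (Reg \o half_turn)) => //.
  - exact: star_like_half_turn.
  - by move=> x y; split=> /asboolP.
  apply: bf => x y /asboolP[[x0 y0] _ _ _ /sees_half_turn see]; split=> //.
  by apply: contraTneq x0 => ->; rewrite -leNgt ltW.
have b5 : (#|[set e | level e.1 e.2]| <= #|{: P}| * 2)%N.
  pose Z := [set x : P | (pos x).2 == 0].
  have Z2 : (#|Z| <= 2)%N.
    have [p [q pq]] := horizontal_points ray.
    have : (size (undup (map val (enum Z))) <= size [:: p; q])%N.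
      apply: uniq_leq_size; first exact: undup_uniq.
      move=> k; rewrite mem_undup => /mapP[x]; rewrite mem_enum inE subr_eq0 => /eqP x0 ->.
      by rewrite !inE; case: (pq (val x)) => [||->|->]; rewrite ?eqxx ?orbT //; apply/PK/valP.
    rewrite undup_id; last by rewrite map_inj_uniq ?enum_uniq //; exact: val_inj.
    by rewrite size_map -cardE.
  apply: (@leq_trans (#|{: P}| * #|Z|)); last by rewrite leq_mul2l Z2 orbT.
  apply: (@card_pairs_le _ _ level) => [x y|x _]; first by rewrite inE.
  exact: max_card.
apply: (@leq_trans (\sum_(E <- [:: half Reg pos; half (Reg \o half_turn) (half_turn \o pos);
    opp Reg pos; opp (Reg \o half_turn) (half_turn \o pos); level]) #|[set e | E e.1 e.2]|)); last first.
  by rewrite !big_cons big_nil; nia.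
apply: edges_cover => x y /visibility_sees[xy /sees_pos see] /=.
have see' := sees_sym see.
have anti p q : wedge p q = - wedge q p by rewrite /wedge; ring.
have T1 := tip_half_turn (tips x); have T2 := tip_half_turn (tips y).
have halfP u v : 0 < (pos u).2 * (pos v).2 -> u != v -> sees Reg (pos u) (pos v) ->
    wedge (pos u) (pos v) != 0.
  move=> uv nuv suv; apply: contra_neq nuv => c0; apply/pos_inj.
  have : (pos u).2 * (pos v).2 != 0 by rewrite gt_eqF.
  rewrite mulf_eq0 negb_or => /andP[u0 v0].
  apply: (same_ray (tips u) (tips v) (sees_l suv) (sees_r suv) uv).
  by apply/eqP; rewrite eqr_div // -subr_eq0 [X in _ - X]mulrC; apply/eqP.
have [y0|y0|y0] := ltgtP (pos y).2 0; last by rewrite /level y0 eqxx !orbT.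
- have [x0|x0|x0] := ltgtP (pos x).2 0; last by rewrite /level x0 eqxx !orbT.
  + have := halfP _ _ (_ : 0 < (pos x).2 * (pos y).2) xy see.
    rewrite nmulr_rgt0 // => /(_ y0); case: ltgtP => // c0 _.
      have -> : half (Reg \o half_turn) (half_turn \o pos) y x.
        apply/asboolP; split=> //; first by rewrite /= !oppr_gt0.
          by rewrite /= wedge_half_turn anti oppr_gt0.
        exact/sees_half_turn.
      by rewrite !orbT.
    have -> : half (Reg \o half_turn) (half_turn \o pos) x y.
      apply/asboolP; split=> //; first by rewrite /= !oppr_gt0.
        by rewrite /= wedge_half_turn.
      exact/sees_half_turn.
    by rewrite !orbT.
  have [c0|c0] := leP 0 (wedge (pos x) (pos y)).
    have -> : opp Reg pos x y by apply/asboolP.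
    by rewrite !orbT.
  have -> : opp (Reg \o half_turn) (half_turn \o pos) y x.
    apply/asboolP; split=> //; first by rewrite /= oppr_gt0 oppr_lt0.
      by rewrite /= wedge_half_turn anti oppr_ge0 ltW.
    exact/sees_half_turn.
  by rewrite !orbT.
have [x0|x0|x0] := ltgtP (pos x).2 0; last by rewrite /level x0 eqxx !orbT.
  have [c0|c0] := leP 0 (wedge (pos x) (pos y)).
    have -> : opp (Reg \o half_turn) (half_turn \o pos) x y.
      apply/asboolP; split=> //; first by rewrite /= oppr_gt0 oppr_lt0.
        by rewrite /= wedge_half_turn.
      exact/sees_half_turn.
    by rewrite !orbT.
  have -> : opp Reg pos y x by apply/asboolP; split=> //; rewrite anti oppr_ge0 ltW.
  by rewrite !orbT.
have := halfP _ _ (mulr_gt0 x0 y0) xy see; case: ltgtP => // c0 _.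
  have -> : half Reg pos y x by apply/asboolP; split=> //; rewrite anti oppr_gt0.
  by rewrite !orbT.
by have -> : half Reg pos x y by apply/asboolP.
Qed.

End Visibility.

Theorem theorem1p8 (R : realType) :
  exists2 C : R, 0 < C &
    forall (n s : nat) (K : set (R * R)) (P : {fset R * R}),
      (0 < n)%N -> (0 < s)%N ->
      jordan_curve K ->
      x_monotone K \/ star_shaped K ->
      (forall p, p \in P -> K p) ->
      #|` P| = n ->
      ~ contains_Kss (visibility_graph K P) s ->
      #|edges (visibility_graph K P)|%:R <= C * s%:R * n%:R.
Proof.
(* the bounds of the five classes of pairs add up to at most 70 in either case *)
exists 70%:R; first by rewrite ltr0n.
move=> n s K P _ s0 jK shape PK <- free.
have : (#|edges (visibility_graph K P)| <= s * (70 * #|{: P}|))%N.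
  case: shape => [mono|star]; last exact: star_edges.
  by apply: leq_trans (x_monotone_edges s0 jK mono PK free) _; nia.
rewrite -cardfE -(ler_nat R) !natrM => le; apply: le_trans le _.
by rewrite mulrA [s%:R * _]mulrC.
Qed.
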